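(* Let $X, Y\subseteq\mathbb{C}$ be perfect compact sets and $(M_n)$ a weight sequence such that $D(X,M)$ is locally good and $D(Y,M)$ is good, and let $\phi:X\to Y$ be analytic. Suppose that $$X=\{z\in X: |\phi'(z)|<1\}\cup\phi^{-1}(\operatorname{int}(Y)).$$ Then $\phi$ induces a compact homomorphism $D(Y,M)\to D(X,M)$.
   Context: For a perfect compact plane set $X$, $f:X\to\mathbb{C}$ is complex-differentiable at $a\in X$ if $f'(a)=\lim_{z\to a,\ z\in X}\frac{f(z)-f(a)}{z-a}$ exists; $f^{(n)}$ denotes the $n$-th complex derivative in this sense (with $f^{(0)}=f$), and $D^\infty(X)$ is the set of infinitely complex-differentiable functions on $X$. A weight sequence is a sequence $(M_n)_{n\ge 0}$ of positive numbers with $M_0=1$ and $\frac{M_{n+m}}{M_nM_m}\ge\binom{n+m}{n}$ for all non-negative integers $m,n$. The Dales-Davie algebra is $$D(X,M)=\Big\{f\in D^\infty(X):\ \|f\|_D=\sum_{n=0}^\infty\frac{\|f^{(n)}\|_\infty}{M_n}<\infty\Big\},$$ where $\|\cdot\|_\infty$ is the supremum norm on $X$. A set $X$ is good if it is a perfect compact plane set and $D(X,M)$ is complete for all weight sequences $(M_n)$. The sequence $(M_n)$ is non-analytic if $\lim_{n\to\infty}(n!/M_n)^{1/n}=0$. $D(X,M)$ is natural if its maximal ideal space is precisely $X$ (every character is evaluation at a point of $X$). The algebra $D(X,M)$ is good if $X$ is good, $(M_n)$ is non-analytic and $D(X,M)$ is natural. The algebra $D(X,M)$ is locally good if $D(X,M)$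 is good and every $x\in X$ has a base of neighbourhoods $N$ in $X$ (i.e. arbitrarily small neighbourhoods, relative to $X$) such that $N$ is good and the algebra $D(N,M)$ is good. A map $\phi\in D^\infty(X)$ is called analytic if $\sup_{k\ge1}\left(\|\phi^{(k)}\|_\infty/k!\right)^{1/k}<\infty$. A map $\phi:X\to Y$ induces a homomorphism $D(Y,M)\to D(X,M)$ if $f\circ\phi\in D(X,M)$ for every $f\in D(Y,M)$; the induced homomorphism is $f\mapsto f\circ\phi$, and it is called compact if it is a compact linear operator. $\operatorname{int}(Y)$ is the interior of $Y$ in $\mathbb{C}$. *)

(* Defs.v *)
From HB Require Import structures.
From mathcomp Require Import all_boot all_order all_algebra.
From mathcomp Require Import complex.
From mathcomp Require Import all_classical all_reals all_analysis.

Set Implicit Arguments.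
Unset Strict Implicit.
Unset Printing Implicit Defensive.

Import Order.TTheory GRing.Theory Num.Theory.
Import numFieldNormedType.Exports ComplexField.Normc.

Local Open Scope classical_set_scope.
Local Open Scope ring_scope.

HB.instance Definition _ (R : realType) := NormedModule.copy R[i] (R[i])^o.

Section ComplexDerivative.
Variables (R : realType) (X : set R[i]).
Implicit Types (f g : X -> R[i]) (a z : X).

(* [z --> a^'] is the punctured neighbourhood filter of the subtype X. *)
Definition cquot f a z : R[i] := (f z - f a) / (set_val z - set_val a).

Definition cderivable f a := cvg (cquot f a z @[z --> a^']).

Definition cderiv f a : R[i] := lim (cquot f a z @[z --> a^']).

Definition cderivn n f : X -> R[i] := iter n cderiv f.

Definition csmooth f := forall n a, cderivable (cderivn n f) a.

(* [sup] is 0 on empty and on unbounded sets; the latter do not arise for the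
   derivatives of a [csmooth] function on a compact X, see [csmooth_has_sup]. *)
Definition sup_norm f : R := sup (range (fun z => normc (f z))).

End ComplexDerivative.

(* The empty set is allowed, so [dales_davie X M] below is a [comPzRingType]
   but not in general a nontrivial ring. *)
Record perfect_compact (R : realType) := PerfectCompact {
  pc_set :> set R[i];
  pc_perfect : perfect_set pc_set;
  pc_compact : compact pc_set }.

Record weight_sequence (R : realType) := WeightSequence {
  weight :> nat -> R;
  weight_gt0 : forall n, 0 < weight n;
  weight0 : weight 0%N = 1;
  weight_binomial : forall m n,
    'C(n + m, n)%:R <= weight (n + m)%N / (weight n * weight m) }.

Section cderiv_theory.
Variables (R : realType) (X : perfect_compact R).
Implicit Types (f g : X -> R[i]) (a z : X) (c : R[i]).

Lemma C_hausdorff : hausdorff_space R[i].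
Proof. exact: norm_hausdorff. Qed.

Lemma pc_dnbhs_proper a : ProperFilter a^'.
Proof.
apply: Build_ProperFilter_ex => P.
case=> /= [B] [[U oU <-] /= Ua] BP.
have : limit_point (X : set R[i]) (set_val a).
  by rewrite (proj2 (pc_perfect X)); exact: set_valP.
move=> /(_ U (open_nbhs_nbhs (conj oU Ua))).
move=> [y [ya Xy Uy]].
exists (exist _ y (mem_set Xy)); apply: BP => //.
Qed.
#[local] Existing Instance pc_dnbhs_proper.

Definition is_cderiv f a (l : R[i]) := cquot f a z @[z --> a^'] --> l.

Lemma cderivableP f a : cderivable f a -> is_cderiv f a (cderiv f a).
Proof. by []. Qed.

Lemma is_cderivP f a l : is_cderiv f a l -> cderivable f a /\ cderiv f a = l.
Proof.
by move=> fl; split; [exact: cvgP fl | exact: (cvg_lim C_hausdorff fl)].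
Qed.

Lemma is_cderivD f g a l m :
  is_cderiv f a l -> is_cderiv g a m -> is_cderiv (f + g) a (l + m).
Proof.
move=> fl gm.
rewrite /is_cderiv (_ : cquot (f + g) a = cquot f a \+ cquot g a).
  by apply: (cvgD fl gm).
by apply/funext => z /=; rewrite /cquot /= -mulrDl addrACA -opprD.
Qed.

Lemma is_cderivZ c f a l : is_cderiv f a l -> is_cderiv (c *: f) a (c * l).
Proof.
move=> fl.
rewrite /is_cderiv (_ : cquot (c *: f) a = (fun z => c * cquot f a z)).
  by apply: (cvgM (cvg_cst c) fl).
by apply/funext => z /=; rewrite /cquot /= mulrA mulrBr.
Qed.

Lemma is_cderiv_cst c a : is_cderiv (fun=> c) a 0.
Proof.
rewrite /is_cderiv (_ : cquot (fun=> c) a = (fun=> 0)); first exact: cvg_cst.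
by apply/funext => z; rewrite /cquot subrr mul0r.
Qed.

Lemma is_cderiv_sum (I : Type) (r : seq I) (F : I -> X -> R[i]) a (l : I -> R[i]) :
  (forall i, is_cderiv (F i) a (l i)) ->
  is_cderiv (\sum_(i <- r) F i) a (\sum_(i <- r) l i).
Proof.
move=> Fl; elim: r => [|i r IH].
  by rewrite !big_nil; apply: is_cderiv_cst.
rewrite !big_cons; apply: is_cderivD IH; apply: Fl.
Qed.

Lemma set_val_cvg a : (set_val z : R[i]) @[z --> a] --> set_val a.
Proof. exact: (@initial_continuous X R[i] set_val a). Qed.

Lemma is_cderiv_dcvg f a l : is_cderiv f a l -> f z @[z --> a^'] --> f a.
Proof.
move=> fl.
have dz : (set_val z - set_val a) @[z --> a^'] --> (0 : R[i]).
  rewrite -(subrr (set_val a)); apply: (cvgB _ (cvg_cst _)).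
  apply: cvg_trans (@set_val_cvg a).
  by apply: cvg_fmap2; apply: nbhs_dnbhs.
have := cvgD (cvgM fl dz) (cvg_cst (f a)).
rewrite mulr0 add0r; move=> h; apply: cvg_trans (h _ _ _); apply: near_eq_cvg.
apply: filterS (@nbhs_dnbhs_neq _ a) => z za.
have E : cquot f a z * (set_val z - set_val a) + f a = f z.
  rewrite /cquot divfK ?subrK// subr_eq0.
  by apply: contra za => /eqP/val_inj ->.
by apply: E.
Qed.

Lemma is_cderiv_continuous f a l : is_cderiv f a l -> {for a, continuous f}.
Proof.
move=> /is_cderiv_dcvg fa U Ufa.
have Ua : a^' (f @^-1` U) := fa U Ufa.
change (nbhs a (f @^-1` U)); rewrite dnbhsE; split => //.
by apply/principal_filterP; exact: (nbhs_singleton Ufa).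
Qed.

Lemma is_cderivM f g a l m : is_cderiv f a l -> is_cderiv g a m ->
  is_cderiv (f * g) a (l * g a + f a * m).
Proof.
move=> fl gm; have ga := is_cderiv_dcvg gm.
apply: cvg_trans (cvgD (cvgM fl ga) (cvgM (cvg_cst (f a)) gm)).
apply: near_eq_cvg; apply: nearW => z.
have E : cquot f a z * g z + f a * cquot g a z = cquot (f * g) a z.
  rewrite /cquot mulrAC mulrA -mulrDl; congr (_ / _).
  by rewrite mulrBl mulrBr addrA subrK.
by apply: E.
Qed.

Lemma normC_normc (x : R[i]) : `|x| = (normc x)%:C%C.
Proof. by []. Qed.

Lemma normc_ge0 (x : R[i]) : 0 <= normc x.
Proof. by rewrite -lecR -normC_normc normr_ge0. Qed.

Lemma normc_triangle (x y : R[i]) : normc (x + y) <= normc x + normc y.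
Proof. by rewrite -lecR rmorphD/= -!normC_normc ler_normD. Qed.

Lemma normc_dist (x y : R[i]) : `|normc x - normc y| <= normc (x - y).
Proof.
have D (u v : R[i]) : normc u - normc v <= normc (u - v).
  by rewrite lerBlDr -[X in normc X <= _](subrK v u) normc_triangle.
rewrite ler_norml D andbT lerNl opprB; apply: le_trans (D y x) _.
by rewrite -lecR -!normC_normc distrC.
Qed.

Lemma normc_continuous : continuous (@normc R).
Proof.
move=> x U /nbhs_ballP [e /= e0 eU].
have e0' : 0 < e%:C%C by rewrite ltcR.
apply: (@filterS _ (nbhs x) (nbhs_filter x) _ _ _ (nbhsx_ballx x _ e0')) => z.
rewrite -!ball_normE /= normC_normc ltcR => xz; apply: eU.
by rewrite -ball_normE; apply: le_lt_trans (normc_dist _ _) xz.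
Qed.

Lemma continuous_has_sup f : continuous f ->
  has_ubound (range (fun z => normc (f z))).
Proof.
move=> cf.
have cnf : continuous (fun z => normc (f z)).
  move=> a; apply: (@continuous_comp _ _ _ f (@normc R)); first exact: cf.
  exact: normc_continuous.
have cv := (@subspace_valL_continuousP' R[i] X R 0 _).2 cnf.
have [M [_ /(_ (M + 1))]] := compact_bounded (continuous_compact cv (@pc_compact R X)).
rewrite ltrDl ltr01 => /(_ isT) bM.
exists (M + 1) => _ [z _ <-]; apply: le_trans (ler_norm _) _; apply: bM => /=.
exists (set_val z); first exact: set_valP.
exact: (f_equal (fun h : X -> R => h z) (@valLK _ _ 0 X (fun z => normc (f z)))).
Qed.

Lemma csmoothP f n a : csmooth f ->
  is_cderiv (cderivn n f) a (cderivn n.+1 f a).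
Proof. by move=> /(_ n a). Qed.

Lemma csmooth_has_sup f n : csmooth f ->
  has_ubound (range (fun z => normc (cderivn n f z))).
Proof.
move=> sf; apply: continuous_has_sup => a.
have H := is_cderiv_continuous (@csmoothP f n a sf).
exact: H.
Qed.

Lemma csmooth_ind (h : nat -> X -> R[i]) :
  (forall n a, is_cderiv (h n) a (h n.+1 a)) ->
  csmooth (h 0%N) /\ forall n, cderivn n (h 0%N) = h n.
Proof.
move=> hE; have E n : cderivn n (h 0%N) = h n.
  elim: n => // n IH; apply/funext => a.
  by rewrite /cderivn iterS -/(cderivn n _) IH (is_cderivP (hE n a)).2.
split; last exact E.
by move=> n a; rewrite E; case: (is_cderivP (hE n a)) => H _; apply: H.
Qed.

Lemma csmoothD f g : csmooth f -> csmooth g ->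
  csmooth (f + g) /\ forall n, cderivn n (f + g) = cderivn n f + cderivn n g.
Proof.
move=> sf sg; apply: (@csmooth_ind (fun n => cderivn n f + cderivn n g)) => n a.
apply: is_cderivD; [apply: (csmoothP sf) | apply: (csmoothP sg)].
Qed.

Lemma csmoothZ c f : csmooth f ->
  csmooth (c *: f) /\ forall n, cderivn n (c *: f) = c *: cderivn n f.
Proof.
move=> sf; apply: (@csmooth_ind (fun n => c *: cderivn n f)) => n a.
apply: is_cderivZ; apply: (csmoothP sf).
Qed.

Lemma csmooth_cst c : csmooth ((fun=> c) : X -> R[i]) /\
  forall n, cderivn n ((fun=> c) : X -> R[i]) =
    ((fun=> if n is 0%N then c else 0) : X -> R[i]).
Proof.
apply: (@csmooth_ind (fun n => fun=> if n is 0%N then c else 0)) => -[|n] a;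
  apply: is_cderiv_cst.
Qed.

Lemma csmoothM f g : csmooth f -> csmooth g ->
  csmooth (f * g) /\ forall n a, cderivn n (f * g) a =
    \sum_(i < n.+1) (cderivn i f a * cderivn (n - i) g a) *+ 'C(n, i).
Proof.
move=> sf sg.
pose h n a := \sum_(i < n.+1) (cderivn i f a * cderivn (n - i) g a) *+ 'C(n, i).
have hE : h 0%N = f * g.
  by apply/funext => a; rewrite /h big_ord_recl big_ord0 addr0 bin0.
have := @csmooth_ind h; rewrite hE => H.
suff /H[sh hn] : forall n a, is_cderiv (h n) a (h n.+1 a).
  by split => // n a; rewrite hn.
move=> n a.
have -> : h n = \sum_(i < n.+1)
    ('C(n, i)%:R : R[i]) *: (cderivn i f * cderivn (n - i) g).
  apply/funext => b; rewrite fct_sumE /h; apply: eq_bigr => i _.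
  by rewrite -mulr_natl.
suff -> : h n.+1 a = \sum_(i < n.+1) 'C(n, i)%:R *
    (cderivn i.+1 f a * cderivn (n - i) g a + cderivn i f a * cderivn (n - i).+1 g a).
  apply: is_cderiv_sum => i; apply: is_cderivZ.
  apply: is_cderivM; [apply: (csmoothP sf) | apply: (csmoothP sg)].
under eq_bigr do rewrite mulr_natl.
under eq_bigr do rewrite mulrnDl.
rewrite /h big_split /= big_ord_recl /= bin0 mulr1n.
under eq_bigr do rewrite /bump add1n subSS binS mulrnDr.
rewrite big_split /= [X in _ + (X + _)]big_ord_recr /= bin_small// mulr0n addr0.
rewrite [in RHS]addrC [X in _ = X + _]big_ord_recl /= bin0 mulr1n subn0.
rewrite -addrA; congr (_ + _); congr (_ + _).
by apply: eq_bigr => i _; rewrite /bump add1n -(subnSK (ltn_ord i)).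
Qed.

Lemma sup_norm_ge0 f : 0 <= sup_norm f.
Proof.
rewrite /sup_norm; set E := (E in sup E).
have [[[_ [z _ _]] ubE]|/sup_out ->//] := pselect (has_sup E).
by apply: le_trans (normc_ge0 (f z)) _; apply: ub_le_sup => //; exists z.
Qed.

Lemma sup_norm_le f (c : R) : 0 <= c -> (forall z, normc (f z) <= c) ->
  sup_norm f <= c.
Proof.
move=> c0 fc; rewrite /sup_norm; set E := (E in sup E).
have [[E0 _]|/sup_out ->//] := pselect (has_sup E).
by apply: ge_sup => // _ [z _ <-].
Qed.

Lemma le_sup_norm f n z : csmooth f ->
  normc (cderivn n f z) <= sup_norm (cderivn n f).
Proof. by move=> sf; apply: (ub_le_sup (csmooth_has_sup n sf)); exists z. Qed.

End cderiv_theory.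

Section dales_davie_def.
Variables (R : realType) (X : perfect_compact R) (M : weight_sequence R).
Implicit Types (f g : X -> R[i]) (c : R[i]).

Definition dd_term f n : R := sup_norm (cderivn n f) / M n.

Definition dd_norm f : R := limn (series (dd_term f)).

Definition dd_pred : {pred X -> R[i]} :=
  fun f => `[< csmooth f /\ cvgn (series (dd_term f)) >].

Record dales_davie := DalesDavie { dd_fun :> X -> R[i]; _ : dd_fun \in dd_pred }.

HB.instance Definition _ := [isSub for dd_fun].
HB.instance Definition _ := [Choice of dales_davie by <:].

Lemma dd_predP f :
  reflect (csmooth f /\ cvgn (series (dd_term f))) (f \in dd_pred).
Proof. exact: asboolP. Qed.

Lemma dd_term_ge0 f n : 0 <= dd_term f n.
Proof. by rewrite divr_ge0 ?sup_norm_ge0// ltW// weight_gt0. Qed.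

Lemma dd_pred_le f g (u : nat -> R) : csmooth f -> cvgn (series u) ->
  (forall n, dd_term f n <= u n) -> f \in dd_pred /\ dd_norm f <= limn (series u).
Proof.
move=> sf cu fu.
have cf : cvgn (series (dd_term f)).
  apply: (series_le_cvg _ _ fu cu); first exact: dd_term_ge0.
  by move=> n; apply: le_trans (fu n); exact: dd_term_ge0.
by split; [apply/dd_predP | exact: lim_series_le].
Qed.

Lemma dd_predD f g : f \in dd_pred -> g \in dd_pred ->
  f + g \in dd_pred /\ dd_norm (f + g) <= dd_norm f + dd_norm g.
Proof.
move=> /dd_predP[sf cf] /dd_predP[sg cg].
have [sfg E] := csmoothD sf sg.
rewrite /dd_norm -lim_seriesD//; apply: dd_pred_le => //.
  exact: is_cvg_seriesD.
move=> n; rewrite fctE /= /dd_term -mulrDl ler_pM2r ?invr_gt0 ?weight_gt0// E.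
apply: sup_norm_le; first by rewrite addr_ge0// sup_norm_ge0.
move=> z; apply: le_trans (normc_triangle _ _) _.
by apply: lerD; apply: le_sup_norm.
Qed.

Lemma dd_predZ c f : f \in dd_pred ->
  c *: f \in dd_pred /\ dd_norm (c *: f) <= normc c * dd_norm f.
Proof.
move=> /dd_predP[sf cf]; have [scf E] := csmoothZ c sf.
rewrite /dd_norm -[_ * _](lim_seriesZ (normc c) cf); apply: dd_pred_le => //.
  exact: is_cvg_seriesZ.
move=> n; have -> : (normc c *: dd_term f) n = normc c * sup_norm (cderivn n f) / M n.
  by rewrite -mulrA.
rewrite /dd_term ler_pM2r ?invr_gt0 ?weight_gt0// E.
apply: sup_norm_le; first by rewrite mulr_ge0 ?sup_norm_ge0 ?normc_ge0.
move=> z; rewrite [X in normc X]/(_ * _) normcM.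
by rewrite ler_wpM2l ?normc_ge0 ?le_sup_norm.
Qed.

Lemma dd_pred_cst c : (fun=> c) \in dd_pred.
Proof.
have [sc E] := csmooth_cst X c.
pose u n := if n is 0%N then normc c else 0 : R.
apply: (@dd_pred_le _ 0 u _ _ _).1 => //.
  apply/cvg_ex; exists (normc c); apply: cvg_near_cst; exists 1%N => // -[//|n _].
  rewrite /series/= big_nat_recl//= big1 ?addr0//.
move=> n; rewrite /dd_term E; case: n => [|n] /=.
  by rewrite weight0 divr1; apply: sup_norm_le => //; exact: normc_ge0.
rewrite pmulr_lle0 ?invr_gt0 ?weight_gt0//; apply: sup_norm_le => // z.
by rewrite normc0.
Qed.

Lemma dd_norm_ge0 f : f \in dd_pred -> 0 <= dd_norm f.
Proof.
move=> /dd_predP[_ cf]; apply: limr_ge => //.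
by apply: nearW => n; apply: sumr_ge0 => i _; exact: dd_term_ge0.
Qed.

Lemma dd_norm_eq0 f : f \in dd_pred -> dd_norm f = 0 -> f = 0.
Proof.
move=> /dd_predP[sf cf] f0; apply/funext => z; apply: eq0_normc; apply/eqP.
rewrite eq_le normc_ge0 andbT -f0.
apply: le_trans (@le_sup_norm _ _ f 0 z sf) _.
have : series (dd_term f) 1 <= dd_norm f.
  apply: nondecreasing_cvgn_le cf 1%N.
  by apply: nondecreasing_series => n _ _; exact: dd_term_ge0.
by rewrite /series/= big_nat1 /dd_term weight0 divr1.
Qed.

Lemma sum_cauchy_prod (a b : nat -> R) N :
  \sum_(n < N) \sum_(i < n.+1) a i * b (n - i)%N =
  \sum_(i < N) a i * \sum_(j < N - i) b j.
Proof.
elim: N => [|N IH]; first by rewrite !big_ord0.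
rewrite big_ord_recr /= {}IH [RHS]big_ord_recr /= subSnn big_ord1.
rewrite [X in _ + X]big_ord_recr /= subnn addrA -big_split /=; congr (_ + _).
apply: eq_bigr => i _.
by rewrite subSn ?(ltnW (ltn_ord i))// big_ord_recr /= mulrDr.
Qed.

Lemma dd_predM f g : f \in dd_pred -> g \in dd_pred ->
  f * g \in dd_pred /\ dd_norm (f * g) <= dd_norm f * dd_norm g.
Proof.
move=> fD gD; have /dd_predP[sf cf] := fD; have /dd_predP[sg cg] := gD.
have [sfg E] := csmoothM sf sg.
pose u n := \sum_(i < n.+1) dd_term f i * dd_term g (n - i).
have u0 n : 0 <= u n.
  by apply: sumr_ge0 => i _; rewrite mulr_ge0 ?dd_term_ge0.
have part h N : h \in dd_pred -> series (dd_term h) N <= dd_norm h.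
  move=> /dd_predP[_ ch]; apply: nondecreasing_cvgn_le ch N.
  by apply: nondecreasing_series => n _ _; exact: dd_term_ge0.
have ub N : series u N <= dd_norm f * dd_norm g.
  rewrite /series/= big_mkord sum_cauchy_prod.
  apply: (@le_trans _ _ (\sum_(i < N) dd_term f i * dd_norm g)).
    apply: ler_sum => i _; rewrite ler_wpM2l ?dd_term_ge0//.
    by have := part g (N - i)%N gD; rewrite /series/= big_mkord.
  rewrite -mulr_suml ler_wpM2r ?dd_norm_ge0//.
  by have := part f N fD; rewrite /series/= big_mkord.
have cu : cvgn (series u).
  apply: nondecreasing_is_cvgn.
    by apply: nondecreasing_series => n _ _; exact: u0.
  by exists (dd_norm f * dd_norm g) => _ [N _ <-].
have [|fgD le] := @dd_pred_le (f * g) f u sfg cu.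
  move=> n; rewrite /dd_term ler_pdivrMr ?weight_gt0//.
  have Mn := weight_gt0 M n.
  apply: sup_norm_le; first by rewrite mulr_ge0// ltW.
  move=> z; rewrite E mulr_suml.
  apply: (@le_trans _ _ (\sum_(i < n.+1)
      normc (cderivn i f z * cderivn (n - i) g z *+ 'C(n, i)))).
    elim/big_ind2 : _ => [|x y x' y' hx hy|//]; first by rewrite normc0.
    by apply: le_trans (normc_triangle _ _) _; exact: lerD.
  apply: ler_sum => i _.
  have -> (x : R[i]) k : normc (x *+ k) = normc x *+ k.
    by apply: (complexI (R := R)); rewrite rmorphMn /= -!normC_normc normrMn.
  rewrite normcM -mulr_natr /dd_term mulf_div -[leRHS]mulrA.
  apply: ler_pM; rewrite ?mulr_ge0 ?normc_ge0//.
    by apply: ler_pM; rewrite ?normc_ge0 ?le_sup_norm.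
  have := weight_binomial M (n - i) i.
  rewrite subnKC; last by rewrite -ltnS.
  by rewrite [X in _ <= X]mulrC.
split=> //; apply: le_trans le _; apply: limr_le => //.
by apply: nearW => N; exact: ub.
Qed.

Fact dd_pred_submod_closed : submod_closed dd_pred.
Proof.
split=> [|c f g fD gD]; first exact: dd_pred_cst.
by apply: (dd_predD _ gD).1; apply: (dd_predZ c fD).1.
Qed.

Fact dd_pred_mulr_closed : mulr_closed dd_pred.
Proof.
split=> [|f g fD gD]; first exact: dd_pred_cst.
by apply: (dd_predM fD gD).1.
Qed.

HB.instance Definition _ :=
  GRing.isSubmodClosed.Build R[i] (X -> R[i]) dd_pred dd_pred_submod_closed.
HB.instance Definition _ :=
  GRing.isMulClosed.Build (X -> R[i]) dd_pred dd_pred_mulr_closed.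
HB.instance Definition _ :=
  GRing.SubChoice_isSubComPzRing.Build _ _ dales_davie (subringClosedP _).
HB.instance Definition _ := [SubZmodule_isSubLmodule of dales_davie by <:].

Lemma dd_funP (f : dales_davie) : (f : X -> R[i]) \in dd_pred.
Proof. by case: f. Qed.

(* Norms of modules over the field R[i] take their values in R[i]. *)
Definition dales_davie_norm (f : dales_davie) : R[i] := (dd_norm f)%:C%C.

Fact dales_davie_ler_normD (f g : dales_davie) :
  dales_davie_norm (f + g) <= dales_davie_norm f + dales_davie_norm g.
Proof. by rewrite -rmorphD lecR; apply: (dd_predD (dd_funP f) (dd_funP g)).2. Qed.

Fact dales_davie_normrZ (c : R[i]) (f : dales_davie) :
  dales_davie_norm (c *: f) = `|c| * dales_davie_norm f.
Proof.
rewrite normC_normc -rmorphM; congr (_%:C)%C.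
have le (d : R[i]) (g : dales_davie) : dd_norm (d *: g) <= normc d * dd_norm g.
  exact: (dd_predZ d (dd_funP g)).2.
apply/eqP; rewrite eq_le le /=.
have [->|c0] := eqVneq c 0.
  by rewrite normc0 mul0r; apply: dd_norm_ge0; apply: (dd_funP (0 *: f)).
have := le c^-1 (c *: f); rewrite scalerA mulVf// scale1r normcV ler_pdivlMl//.
by rewrite lt_neqAle normc_ge0 andbT eq_sym; apply: contra c0 => /eqP/eq0_normc ->.
Qed.

Fact dales_davie_normr0_eq0 (f : dales_davie) : dales_davie_norm f = 0 -> f = 0.
Proof.
move=> [/(dd_norm_eq0 (dd_funP f)) f0]; apply: val_inj; exact: f0.
Qed.

HB.instance Definition _ := Lmodule_isNormed.Build R[i] dales_davie
  dales_davie_ler_normD dales_davie_normrZ dales_davie_normr0_eq0.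

Lemma dales_davie_normE (f : dales_davie) : `|f| = (dd_norm f)%:C%C.
Proof. by []. Qed.

End dales_davie_def.

(* The axiom of [completeType], as a property. *)
Definition complete_space (T : puniformType) : Prop :=
  forall F : set_system T, ProperFilter F -> cauchy F -> cvg F.

Definition compact_operator (K : numFieldType) (V W : normedModType K)
    (T : {linear V -> W}) : Prop :=
  forall A : set V, bounded_set A -> precompact (T @` A).

Section good_algebras.
Variable R : realType.
Implicit Types (X N : perfect_compact R) (M : weight_sequence R).

Definition good_set X : Prop :=
  forall M, complete_space (dales_davie X M).

Definition non_analytic M : Prop :=
  (n`!%:R / M n) `^ n%:R^-1 @[n --> \oo] --> (0 : R).

Definition character X M (chi : {scalar dales_davie X M}) : Prop :=
  (exists f, chi f != 0) /\ {morph chi : f g / f * g}.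

Definition natural_algebra X M : Prop :=
  forall chi : {scalar dales_davie X M}, character chi ->
  exists x : X, forall f, chi f = f x.

Definition good_algebra X M : Prop :=
  [/\ good_set X, non_analytic M & natural_algebra X M].

Definition locally_good X M : Prop :=
  good_algebra X M /\
  forall (x : X) (U : set R[i]), nbhs (set_val x) U ->
  exists N, [/\ within X (nbhs (set_val x)) N, N `<=` X `&` U,
                good_set N & good_algebra N M].

Definition analytic_map X (phi : X -> R[i]) : Prop :=
  csmooth phi /\
  has_ubound [set (sup_norm (cderivn k phi) / k`!%:R) `^ k%:R^-1
             | k in [set k | (1 <= k)%N]].

End good_algebras.

(* Main.v *)
Require Import Defs.
From HB Require Import structures.
From mathcomp Require Import all_boot all_order all_algebra.
From mathcomp Require Import complex ring lra.
From mathcomp Require Import all_classical all_reals all_analysis.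

Set Implicit Arguments.
Unset Strict Implicit.
Unset Printing Implicit Defensive.

Import Order.TTheory GRing.Theory Num.Theory.
Import numFieldNormedType.Exports ComplexField.Normc.

Local Open Scope classical_set_scope.
Local Open Scope ring_scope.

(** Why the theorem holds.

    The norm of [f \o phi] is a weighted sum, over n, of suprema of n-th
    derivatives, and the n-th derivative of a composite at z only involves the
    derivatives of f at [phi z].  Everything can therefore be estimated point
    by point.  By compactness there is [e > 0] such that each z in X satisfies
    [|phi'(z)| <= 1 - e] or has the whole disc of radius e about [phi z] inside
    Y ([uniform_cover]), and the two kinds of points are treated separately.

    Faa di Bruno's formula is used through generating functions.  If y is a
    real polynomial whose coefficients are nonnegative and, in the degrees 1
    to N, dominate the Taylor coefficients of phi at z, then for [n <= N]
      [|(f \o phi)^(n)(z)| / n! <= \sum_k |f^(k)(phi z)| / k! * [t^n] y(t)^k]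
    ([faa_di_bruno_le]).  The inequality satisfied by the weights gives
    [(n! / M_n) / (k! / M_k) <= (n-k)! / M_(n-k)], and by non-analyticity the
    right-hand side is at most [K x^(n-k)] for any chosen [x > 0].  Summing
    over n turns the coefficients of [y^k] into the value [(y(x) / x)^k]
    ([majorant_sum_le]).  For the polynomials y in use, which have no
    constant term, [y(x) / x] tends to the linear coefficient as x tends to 0,
    so points of the first kind contribute at most
    [\sum_k K q^k |f^(k)|_oo / M_k] with [q < 1].  At points of the second
    kind Cauchy's estimate [|f^(k)| <= k! D^k |f|_oo] ([cauchy_estimate])
    replaces all derivatives of f by f itself, at the cost of a geometric
    factor that the weights absorb; they contribute [K' |f|_oo].  The sum of
    the two bounds is [composition_estimate].

    Cauchy's estimate rests on a maximum principle for functions with a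
    second-order expansion at every point: averaging over [b + t], [b - t],
    [b + 'i t], [b - 'i t] kills the terms of order 1 and 2, so that
    [|h|^2 + e |z - a|^2] has no interior maximum.  It is applied to the
    difference quotient of f at a, which expands at a as well, by Taylor's
    inequality.

    It remains to see that the operator is compact.  By [composition_estimate],
    on a bounded set the image [T h] is small as soon as finitely many
    derivatives of h are uniformly small.  A bound on [f^(k+1)] does not make
    the functions [f^(k)] equicontinuous, because Y need not contain short
    paths between nearby points; equicontinuity comes instead from the
    completeness of D(Y,M).  The difference quotients of [f^(k)] at a fixed
    point z are bounded functionals of f, bounded for each f since [f^(k)] is
    differentiable at z, hence uniformly bounded on the unit ball
    ([equilipschitz_at]).  The argument of
    Arzela and Ascoli then splits a bounded set into finitely many classes on
    which the first K derivatives vary by at most e ([derivatives_coloring]);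
    so the image is totally bounded, and precompact since D(X,M) is complete
    ([precompact_of_coloring]). *)

(** * Modulus and topology of the complex numbers *)

Section Modulus.
Variable R : realType.
Implicit Types (x y a b : R[i]).

Lemma normc_sqr x : normc x ^+ 2 = complex.Re x ^+ 2 + complex.Im x ^+ 2.
Proof. by case: x => u v; rewrite /= sqr_sqrtr// addr_ge0// sqr_ge0. Qed.

Lemma normc_distC x y : normc (x - y) = normc (y - x).
Proof. by rewrite -normcN opprB. Qed.

Lemma normc_real (r : R) : normc (r%:C)%C = `|r|.
Proof. by rewrite /= expr0n addr0 sqrtr_sqr. Qed.

Lemma normcX x n : normc (x ^+ n) = normc x ^+ n.
Proof.
by elim: n => [|n IH]; rewrite ?expr0 ?normc1// !exprS normcM IH.
Qed.

Lemma Re_le_normc x : `|complex.Re x| <= normc x.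
Proof. by rewrite -lecR -normC_normc; exact: normc_ge_Re. Qed.

Lemma normc_gt0 x : (0 < normc x) = (x != 0).
Proof.
rewrite lt_neqAle normc_ge0 andbT eq_sym; apply/idP/idP; apply: contra.
  by move=> /eqP ->; rewrite normc0.
by move=> /eqP/eq0_normc ->.
Qed.

Lemma normc_conj x : normc (conjc x) = normc x.
Proof. by case: x => u v; rewrite /= sqrrN. Qed.

Lemma ReB x y : complex.Re (x - y) = complex.Re x - complex.Re y.
Proof. by case: x; case: y. Qed.

Lemma Re_mulr_real x (r : R) : complex.Re (x * (r%:C)%C) = complex.Re x * r.
Proof. by case: x => u v; rewrite /= mulr0 subr0. Qed.

Lemma ReD x y : complex.Re (x + y) = complex.Re x + complex.Re y.
Proof. by case: x; case: y. Qed.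

Lemma Im_le_normc x : `|complex.Im x| <= normc x.
Proof.
have := Re_le_normc (x * - 'i%C); rewrite normcM normcN.
by case: x => a b /=; rewrite oppr0 !mulr0 mulrN1 sub0r opprK expr0n expr1n add0r sqrtr1 mulr1.
Qed.

Lemma normc_le_ReIm x :
  normc x <= `|complex.Re x| + `|complex.Im x|.
Proof.
rewrite -(ler_pXn2r (_ : 0 < 2)%N) ?nnegrE ?normc_ge0 ?addr_ge0//.
rewrite normc_sqr sqrrD !real_normK ?num_real// addrAC lerDl.
by rewrite mulrn_wge0// mulr_ge0.
Qed.

Lemma nbhs_normcP a (P : set R[i]) :
  nbhs a P <-> exists2 d : R, 0 < d & forall z, normc (z - a) < d -> P z.
Proof.
split=> [/nbhs_ballP[[e ei]] /= |[d d0 dP]].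
  rewrite ltcE /= => /andP[/eqP ei0 e0] eP; rewrite ei0 in eP.
  exists e => // z za; apply: eP; rewrite -ball_normE /= normC_normc ltcR.
  by rewrite normc_distC.
apply/nbhs_ballP; exists d%:C%C => /=; first by rewrite ltcR.
by move=> z; rewrite -ball_normE /= normC_normc ltcR normc_distC; exact: dP.
Qed.

Lemma nbhs_normc a (d : R) : 0 < d ->
  nbhs a [set u : R[i] | normc (u - a) < d].
Proof. by move=> d0; apply/nbhs_normcP; exists d. Qed.

Lemma dist_continuous a (z : R[i]) :
  {for z, continuous (fun z : R[i] => normc (z - a))}.
Proof.
have cB : {for z, continuous (fun z : R[i] => z - a)}.
  exact: (cvgB cvg_id (cvg_cst a)).
exact: (@continuous_comp R[i] R[i] R _ (@normc R) z cB (@normc_continuous R _)).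
Qed.

Lemma normc_sum (I : Type) (r : seq I) (P : pred I) (F : I -> R[i]) :
  normc (\sum_(i <- r | P i) F i) <= \sum_(i <- r | P i) normc (F i).
Proof.
elim/big_ind2 : _ => [|x y x' y' hx hy|//]; first by rewrite normc0.
by apply: le_trans (normc_triangle _ _) _; exact: lerD.
Qed.

End Modulus.

Section Restriction.
Variables (R : realType) (X : perfect_compact R).
Implicit Types (f : X -> R[i]) (a z : X).

Lemma nbhs_set_valP a (P : set X) : nbhs a P <->
  exists2 d : R, 0 < d & forall z, normc (set_val z - set_val a) < d -> P z.
Proof.
split=> [|[d d0 dP]].
  case=> /= [B] [[U oU <-] /= Ua] BP.
  have /nbhs_normcP[d d0 dU] : nbhs (set_val a : R[i]) U.
    exact: (open_nbhs_nbhs (conj oU Ua)).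
  by exists d => // z /dU Uz; exact: BP.
apply: (@filterS _ (nbhs a) (nbhs_filter a) _ _ _
  (@set_val_cvg _ X a _ (nbhs_normc (set_val a) d0))) => z.
exact: dP.
Qed.

Lemma is_cderivE f a l : is_cderiv f a l <->
  forall e : R, 0 < e -> exists2 d : R, 0 < d & forall z : X,
    normc (set_val z - set_val a) < d ->
    normc (f z - f a - l * (set_val z - set_val a)) <=
      e * normc (set_val z - set_val a).
Proof.
have E z : z != a -> normc (f z - f a - l * (set_val z - set_val a)) =
    normc (cquot f a z - l) * normc (set_val z - set_val a).
  move=> za; have vza : set_val z - set_val a != 0 :> R[i].
    by rewrite subr_eq0; apply: contra za => /eqP/val_inj ->.
  by rewrite -normcM mulrBl /cquot divfK.
split=> [fl e e0|H].
  have := fl _ (nbhs_normc l e0); rewrite /nbhs /= /dnbhs /within /= => /nbhs_set_valP[d d0 dP].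
  exists d => // z zd.
  have [->|za] := eqVneq z a; first by rewrite !subrr mulr0 subr0 normc0 mulr0.
  by rewrite E// ler_wpM2r ?normc_ge0// ltW// dP.
move=> P /nbhs_normcP[e e0 eP].
have [d d0 dP] := H (e / 2) ltac:(by rewrite divr_gt0).
apply/nbhs_set_valP; exists d => // z zd za; apply: eP.
have := dP z zd; rewrite E//.
have vza : 0 < normc (set_val z - set_val a).
  rewrite normc_gt0 subr_eq0; apply: contra za => /eqP/val_inj ->; exact: eqxx.
by rewrite ler_pM2r// => /le_lt_trans; apply; rewrite ltr_pdivrMr//; lra.
Qed.

Lemma set_val_compact : compact [set: X].
Proof.
apply/compact_near_coveringP => I F P FF H.
pose Q i u := forall h : u \in (X : set R[i]), P i (exist _ u h).
have cQ : forall u, (X : set R[i]) u -> \forall u' \near u & i \near F, Q i u'.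
  move=> u Xu; have [[A B] /= [/nbhs_set_valP[d d0 dA] FB] AB] :=
    H (exist _ u (mem_set Xu)) Logic.I.
  exists ([set v | normc (v - u) < d], B).
    by split=> //=; exact: nbhs_normc.
  move=> [v i] /= [vd Bi] h; apply: (AB (exist _ v h, i)); split => //=.
  exact: dA.
have := (@compact_near_coveringP _ X).1 (@pc_compact _ X) I F Q FF cQ.
apply: filterS => i Xi [u h] _; exact: (Xi u (set_mem h) h).
Qed.

End Restriction.

(** * Complex derivatives as approximations *)

Section DerivativeAsApproximation.
Variable K : numFieldType.
Implicit Types (f : K -> K) (x l : K).

(** Estimates are easier in this form: quotients by the increment disappear, and
    the increment 0 is no exception. *)
Lemma is_deriveE f x l : is_derive x 1 f l <->
  forall e, 0 < e ->
    \forall h \near (0 : K), `|f (x + h) - f x - l * h| <= e * `|h|.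
Proof.
have E h : h != 0 -> `|f (x + h) - f x - l * h| =
    `|l - h^-1 *: ((f \o shift x) (h *: 1) - f x)| * `|h|.
  move=> h0; rewrite -normrM -[RHS]normrN mulrBl opprB.
  have -> : (f \o shift x) (h *: 1) = f (x + h).
    by rewrite /= addrC [h *: 1]mulr1.
  by rewrite [_ *: _]mulrC divfK.
have toC : is_derive x 1 f l <->
    h^-1 *: ((f \o shift x) (h *: 1) - f x) @[h --> 0^'] --> l.
  split=> [[dv <-]|cv]; first exact: dv.
  by apply: DeriveDef; [exact: cvgP cv | exact: cvg_lim cv].
split=> [/toC /cvgrPdist_le H e e0|H].
  have := H e e0; rewrite near_withinE; apply: filterS => h hP.
  have [->|h0] := eqVneq h 0; first by rewrite addr0 subrr mulr0 subr0 normr0 mulr0.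
  by rewrite E// ler_wpM2r//; exact: hP.
apply/toC/cvgrPdist_le => e e0.
rewrite near_withinE; apply: filterS (H e e0) => h hP h0.
by move: hP; rewrite E// ler_pM2r// normr_gt0.
Qed.

End DerivativeAsApproximation.

Section ComplexApprox.
Variable R : realType.

Lemma le_norm_normc (x y : R[i]) (e : R) :
  (`|x| <= (e%:C)%C * `|y|) = (normc x <= e * normc y).
Proof.
by rewrite -lecR rmorphM.
Qed.

Lemma is_derive_normc (F : R[i] -> R[i]) (u l : R[i]) : is_derive u 1 F l <->
  forall e : R, 0 < e -> exists2 d : R, 0 < d & forall t, normc t < d ->
    normc (F (u + t) - F u - l * t) <= e * normc t.
Proof.
have H := @is_deriveE R[i] F u l.
split=> [/H {}H e e0|H0].
  have := H e%:C%C; rewrite ltcR => /(_ e0) /nbhs_normcP[d d0 dP].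
  exists d => // t td; have := dP t; rewrite subr0 => /(_ td).
  by rewrite le_norm_normc.
refine (H.2 _) => -[e ei]; rewrite ltcE /= => /andP[/eqP -> /H0[d d0 dP]].
apply/nbhs_normcP; exists d => // t; rewrite subr0 => td.
by rewrite le_norm_normc dP.
Qed.
End ComplexApprox.

(** * Mean value inequality and Taylor bound *)

Section Taylor.
Variable R : realType.
Implicit Types (F G : R[i] -> R[i]) (a t u : R[i]).

(** The real mean value theorem for [s |-> Re (conj D * F (a + s t))], where D is
    the total increment: the real part of [conj D * D] is [|D|^2]. *)
Lemma mean_value_normc F (F' : R[i] -> R[i]) a t (m : R) :
  (forall s : R, 0 <= s <= 1 ->
     is_derive (a + (s%:C)%C * t) 1 F (F' (a + (s%:C)%C * t)) /\
     normc (F' (a + (s%:C)%C * t)) <= m) ->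
  normc (F (a + t) - F a) <= m * normc t.
Proof.
move=> H; set D := F (a + t) - F a.
have m0 : 0 <= m.
  by have [_] := H 0 ltac:(by rewrite lexx ler01); apply/le_trans/normc_ge0.
pose g (s : R) := a + (s%:C)%C * t.
pose p (s : R) := complex.Re (conjc D * F (g s)).
pose p' (s : R) := complex.Re (conjc D * (F' (g s) * t)).
have dp (s : R) : 0 <= s <= 1 -> is_derive s 1 p (p' s).
  move=> /H[/is_derive_normc {}H _]; apply/is_deriveE => e e0.
  have k0 : 0 < normc D * normc t + 1 by rewrite ltr_wpDl// mulr_ge0// normc_ge0.
  have [d d0 dP] := H (e / (normc D * normc t + 1)) ltac:(by rewrite divr_gt0).
  have d'0 : 0 < d / (normc t + 1) by rewrite divr_gt0// ltr_wpDl// normc_ge0.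
  have := @pseudometric_normed_Zmodule.nbhs0_lt R R _ d'0.
  apply: filterS => h hd'.
  have hd : normc ((h%:C)%C * t) < d.
    rewrite normcM normc_real; apply: (@le_lt_trans _ _ (`|h| * (normc t + 1))).
      by rewrite ler_wpM2l// lerDl.
    by rewrite -ltr_pdivlMr ?ltr_wpDl ?normc_ge0.
  have -> : p (s + h) - p s - p' s * h = complex.Re
    (conjc D * (F (g s + (h%:C)%C * t) - F (g s) - F' (g s) * ((h%:C)%C * t))).
    rewrite /p /p' -Re_mulr_real -!ReB; congr complex.Re.
    have -> : g (s + h) = g s + (h%:C)%C * t.
      by rewrite /g rmorphD mulrDl addrA.
    ring.
  apply: le_trans (Re_le_normc _) _; rewrite normcM normc_conj.
  apply: (@le_trans _ _ (normc D * (e / (normc D * normc t + 1) * normc ((h%:C)%C * t)))).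
    by rewrite ler_wpM2l ?normc_ge0// dP.
  rewrite normcM normc_real.
  have -> : normc D * (e / (normc D * normc t + 1) * (`|h| * normc t)) =
     e * `|h| * ((normc D * normc t) / (normc D * normc t + 1)) by ring.
  apply: ler_piMr; first by rewrite mulr_ge0// ltW.
  by rewrite ler_pdivrMr// mul1r lerDl.
have [||c] := @MVT_segment R p p' 0 1 ler01.
- by move=> s; rewrite in_itv /= => /andP[s0 s1]; apply: dp; rewrite !ltW.
- apply: derivable_within_continuous => s; rewrite in_itv /= => /andP[s0 s1].
  by have [] := dp s ltac:(by rewrite s0).
rewrite in_itv /= => /andP[c0 c1]; rewrite subr0 mulr1 /p -ReB.
have -> : conjc D * F (g 1) - conjc D * F (g 0) = conjc D * D.
  by rewrite /g rmorph1 rmorph0 mul1r mul0r addr0 mulrBr.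
have -> : complex.Re (conjc D * D) = normc D ^+ 2.
  by rewrite normc_sqr; case: (D) => x y /=; ring.
move=> E; have le2 : normc D ^+ 2 <= normc D * (m * normc t).
  rewrite E; apply: le_trans (ler_norm _) _; apply: le_trans (Re_le_normc _) _.
  rewrite normcM normc_conj ler_wpM2l ?normc_ge0// normcM ler_wpM2r ?normc_ge0//.
  by have [_] := H c ltac:(by rewrite c0).
have := normc_ge0 D; rewrite le_eqVlt => /orP[/eqP <-|D0].
  by rewrite mulr_ge0// normc_ge0.
by rewrite -(ler_pM2l D0) -expr2.
Qed.

Lemma is_derive_shift_exp (c a u : R[i]) (k : nat) :
  is_derive u 1 (fun z : R[i] => c * (z - a) ^+ k) (c * (k%:R * (u - a) ^+ k.-1)).
Proof.
have dsub : is_derive u 1 (fun z : R[i] => z - a) 1.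
  have := is_deriveB (is_derive_id u (1 : R[i])) (is_derive_cst a u 1).
  by rewrite subr0.
have := is_deriveZ c (is_deriveX k dsub).
rewrite (_ : _ ^+ k = (fun z : R[i] => (z - a) ^+ k)).
  by rewrite [_ *: 1]mulr1.
by apply/funext => z; elim: k => // k IH; rewrite !exprS fctE IH.
Qed.

(** By induction on N: the derivative of the remainder of order N+1 of [G 0] is
    the remainder of order N of [G 1].  The factorial of the usual remainder is
    given up, since only the order in t matters below. *)
Lemma taylor_normc (N : nat) (G : nat -> R[i] -> R[i]) a (r S : R) :
  (forall n u, normc (u - a) < r -> is_derive u 1 (G n) (G n.+1 u)) ->
  (forall u, normc (u - a) < r -> normc (G N u) <= S) ->
  forall t, normc t < r ->
  normc (G 0%N (a + t) - \sum_(k < N) G k a / k`!%:R * t ^+ k) <= S * normc t ^+ N.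
Proof.
elim: N G => [|N IH] G dG bG t tr.
  rewrite big_ord0 subr0 expr0 mulr1; apply: bG.
  by rewrite addrC addKr.
have {}IH := IH (fun n => G n.+1) (fun n => dG n.+1) bG.
pose P u := \sum_(k < N.+1) G k a / k`!%:R * (u - a) ^+ k.
pose P' u := \sum_(k < N) G k.+1 a / k`!%:R * (u - a) ^+ k.
have dP u : is_derive u 1 P (P' u).
  have -> : P = \sum_(k < N.+1) (fun z => G k a / k`!%:R * (z - a) ^+ k).
    by apply/funext => z; rewrite fct_sumE.
  have -> : P' u = \sum_(k < N.+1) G k a / k`!%:R * (k%:R * (u - a) ^+ k.-1).
    rewrite big_ord_recl /= mul0r mulr0 add0r; apply: eq_bigr => k _.
    rewrite /bump add1n /= mulrA; congr (_ * _).
    by rewrite factS mulnC natrM invfM !mulrA divfK// pnatr_eq0.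
  by apply: is_derive_sum => k; exact: is_derive_shift_exp.
have r0 : 0 < r by exact: le_lt_trans (normc_ge0 _) tr.
have P0 : P a = G 0%N a.
  rewrite /P big_ord_recl big1 ?addr0; last first.
    by move=> k _; rewrite subrr expr0n /= mulr0.
  by rewrite expr0 mulr1 fact0 divr1.
have Pt : P (a + t) = \sum_(k < N.+1) G k a / k`!%:R * t ^+ k.
  by apply: eq_bigr => k _; rewrite [a + t]addrC addrK.
have := @mean_value_normc (G 0%N - P) (fun u => G 1%N u - P' u) a t (S * normc t ^+ N).
rewrite -mulrA -exprSr -Pt.
have -> : (G 0%N - P) (a + t) - (G 0%N - P) a = G 0%N (a + t) - P (a + t).
  by rewrite !fctE P0 subrr subr0.
apply => s /andP[s0 s1].
have st : normc ((s%:C)%C * t) <= normc t.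
  by rewrite normcM normc_real ger0_norm// ler_piMl ?normc_ge0.
have str : normc ((s%:C)%C * t) < r by exact: le_lt_trans tr.
split.
  by apply: is_deriveB (dP _); apply: dG; rewrite addrC addKr.
have -> : P' (a + (s%:C)%C * t) = \sum_(k < N) G k.+1 a / k`!%:R * ((s%:C)%C * t) ^+ k.
  by apply: eq_bigr => k _; rewrite [a + _]addrC addrK.
apply: le_trans (IH _ str) _; rewrite ler_wpM2l//.
  by apply: le_trans (normc_ge0 _) (bG a _); rewrite subrr normc0.
by rewrite lerXn2r// ?nnegrE ?normc_ge0.
Qed.
End Taylor.

(** * Maximum principle *)

Section MaximumPrinciple.
Variable R : realType.
Implicit Types (h : R[i] -> R[i]) (a b t x y : R[i]).

(** A pointwise condition, so that it makes sense for the difference quotient at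
    its centre, where no derivative of that quotient is at hand. *)
Definition expand2 h b := exists c1 c2 : R[i], exists2 K : R, 0 <= K &
  exists2 d : R, 0 < d & forall t, normc t < d ->
    normc (h (b + t) - h b - (c1 * t + c2 * t ^+ 2)) <= K * normc t ^+ 3.

Lemma normc_sqrD_ge x y :
  normc x ^+ 2 + 2 * complex.Re (conjc x * y) <= normc (x + y) ^+ 2.
Proof.
rewrite -subr_ge0 !normc_sqr; case: x => u v; case: y => w z /=.
have -> : (u + w) ^+ 2 + (v + z) ^+ 2 - (u ^+ 2 + v ^+ 2 + 2 * (u * w - - v * z))
  = w ^+ 2 + z ^+ 2 by ring.
by rewrite addr_ge0// sqr_ge0.
Qed.

Lemma Re_conj_ge x y : - (normc x * normc y) <= complex.Re (conjc x * y).
Proof.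
rewrite -(normc_conj x) -normcM lerNl; apply: le_trans (Re_le_normc _).
by rewrite -normrN ler_norm.
Qed.

(** Discrete subharmonicity.  The four increments i^k t have zero sum, and so do
    their squares; hence the average of [|h|^2] over them is at least
    [|h b|^2 - O(t^3)], whereas that of [e |z - a|^2] gains [e t^2]. *)
Lemma no_local_max h a b (e r : R) : 0 < e -> 0 < r -> expand2 h b ->
  exists2 t, normc t < r &
    normc (h b) ^+ 2 + e * normc (b - a) ^+ 2 <
    normc (h (b + t)) ^+ 2 + e * normc (b + t - a) ^+ 2.
Proof.
move=> e0 r0 [c1 [c2 [K K0 [d d0 dP]]]].
set H := normc (h b); have H0 : 0 <= H by exact: normc_ge0.
have k0 : 0 < 2 * H * K + 1 by rewrite ltr_wpDl// !mulr_ge0.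
(* tau makes the error 2 H K tau^3 smaller than the gain e tau^2. *)
pose tau := Num.min (Num.min d r) (e / (2 * H * K + 1)) / 2.
have tau0 : 0 < tau by rewrite divr_gt0// !lt_min d0 r0 divr_gt0.
have tau2 : tau < 2 * tau by rewrite ltr_pMl// ltr1n.
have tauE : 2 * tau = Num.min (Num.min d r) (e / (2 * H * K + 1)).
  by rewrite /tau mulrC divfK.
have taud : tau < d by apply: lt_le_trans tau2 _; rewrite tauE !ge_min lexx.
have taur : tau < r by apply: lt_le_trans tau2 _; rewrite tauE !ge_min lexx orbT.
have taue : 2 * H * K * tau < e.
  apply: (@lt_le_trans _ _ ((2 * H * K + 1) * tau)).
    by rewrite ltr_pM2r// ltrDl.
  rewrite mulrC -ler_pdivlMr//; apply/ltW; apply: lt_le_trans tau2 _.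
  by rewrite tauE ge_min lexx orbT.
pose T : R[i] := (tau%:C)%C; pose I : R[i] := 'i%C.
have nT : normc T = tau by rewrite normc_real gtr0_norm.
have nI : normc I = 1 by rewrite /= expr0n expr1n add0r sqrtr1.
have I2 : I ^+ 2 = -1 by exact: sqr_i.
pose E t := h (b + t) - h b - (c1 * t + c2 * t ^+ 2).
have nE t : normc t = tau -> normc (E t) <= K * tau ^+ 3.
  by move=> tt; rewrite -tt; apply: dP; rewrite tt.
have n1 := nT; have n2 : normc (- T) = tau by rewrite normcN.
have n3 : normc (I * T) = tau by rewrite normcM nI mul1r.
have n4 : normc (- (I * T)) = tau by rewrite normcN.
apply: contrapT => nex.
have F t : normc t = tau -> normc (h (b + t)) ^+ 2 + e * normc (b + t - a) ^+ 2
   <= H ^+ 2 + e * normc (b - a) ^+ 2.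
  move=> tt; rewrite leNgt; apply/negP => lt; apply: nex; exists t => //.
  by rewrite tt.
have G t : H ^+ 2 + 2 * complex.Re (conjc (h b) * (h (b + t) - h b)) <=
    normc (h (b + t)) ^+ 2.
  by have := normc_sqrD_ge (h b) (h (b + t) - h b); rewrite (addrC (h b)) subrK.
have SE : (h (b + T) - h b) + (h (b - T) - h b) + (h (b + I * T) - h b) +
    (h (b - I * T) - h b) = E T + E (- T) + E (I * T) + E (- (I * T)).
  rewrite /E !sqrrN exprMn I2; ring.
have L : - (H * (4 * (K * tau ^+ 3))) <=
   complex.Re (conjc (h b) * (E T + E (- T) + E (I * T) + E (- (I * T)))).
  apply: le_trans (Re_conj_ge _ _); rewrite lerN2 ler_wpM2l//.
  have -> : 4 * (K * tau ^+ 3) = K * tau ^+ 3 + K * tau ^+ 3 + K * tau ^+ 3 +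
    K * tau ^+ 3 by ring.
  apply: le_trans (normc_triangle _ _) (lerD _ (nE _ n4)).
  apply: le_trans (normc_triangle _ _) (lerD _ (nE _ n3)).
  exact: le_trans (normc_triangle _ _) (lerD (nE _ n1) (nE _ n2)).
have Q : normc (b + T - a) ^+ 2 + normc (b - T - a) ^+ 2 +
   normc (b + I * T - a) ^+ 2 + normc (b - I * T - a) ^+ 2 =
   4 * normc (b - a) ^+ 2 + 4 * tau ^+ 2.
  rewrite !normc_sqr /T /I; case: (b) => b1 b2; case: (a) => a1 a2 /=; ring.
have := F _ n1; have := F _ n2; have := F _ n3; have := F _ n4.
have := G T; have := G (- T); have := G (I * T); have := G (- (I * T)).
move: L; rewrite -SE !mulrDr !ReD.
move=> L g4 g3 g2 g1 f4 f3 f2 f1.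
have tau3 : e * tau ^+ 2 <= 2 * H * K * tau * tau ^+ 2.
  have -> : 2 * H * K * tau * tau ^+ 2 = 2 * (H * (K * tau ^+ 3)) by ring.
  have {Q} := congr1 (fun q : R => e * q) Q.
  rewrite !mulrDr => Q.
  move: L Q f1 f2 f3 f4 g1 g2 g3 g4.
  rewrite [H * (4 * _)]mulrCA [e * (4 * _)]mulrCA [e * (4 * tau ^+ 2)]mulrCA.
  lra.
move: tau3; rewrite ler_pM2r ?exprn_gt0// leNgt => /negP; exact.
Qed.

Lemma expand2_continuous h b : expand2 h b -> {for b, continuous h}.
Proof.
move=> [c1 [c2 [K K0 [d d0 dP]]]].
move=> U /nbhs_normcP[e e0 eU]; apply/nbhs_normcP.
pose C := normc c1 + normc c2 + K + 1.
have C0 : 0 < C by rewrite ltr_wpDl// !addr_ge0 ?normc_ge0.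
exists (Num.min (Num.min d 1) (e / C)); first by rewrite !lt_min d0 ltr01 divr_gt0.
move=> z; rewrite !lt_min => /andP[/andP[zd z1] ze]; apply: eU.
have := dP _ zd; rewrite (addrC b) subrK.
set t := z - b in zd z1 ze * => tP.
have -> : h z - h b = (h z - h b - (c1 * t + c2 * t ^+ 2)) + (c1 * t + c2 * t ^+ 2).
  by rewrite subrK.
have t0 := normc_ge0 t.
have l2 : normc t ^+ 2 <= normc t by rewrite expr2 ler_piMr// ltW.
have l3 : normc t ^+ 3 <= normc t by rewrite exprS ler_piMr// exprn_ile1// ltW.
apply: (@le_lt_trans _ _ (normc t * C)); last by rewrite -ltr_pdivlMr.
apply: le_trans (normc_triangle _ _) _.
apply: (@le_trans _ _ (K * normc t + (normc c1 * normc t + normc c2 * normc t))).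
  apply: lerD; first by apply: le_trans tP _; rewrite ler_wpM2l.
  apply: le_trans (normc_triangle _ _) _.
  rewrite (normcM c1) (normcM c2) normcX lerD2l.
  by rewrite ler_wpM2l// normc_ge0.
rewrite /C; lra.
Qed.

(** If [|h a|] exceeded m, then [|h|^2 + e |z - a|^2] would, for small e, be larger
    at a than on the circle, and would have a maximum inside the disc. *)
Lemma maximum_principle h a (r m : R) : 0 < r ->
  compact [set z : R[i] | normc (z - a) <= r] ->
  (forall b, normc (b - a) <= r -> expand2 h b) ->
  (forall b, normc (b - a) = r -> normc (h b) <= m) ->
  normc (h a) <= m.
Proof.
move=> r0 cD hE hm.
have m0 : 0 <= m.
  apply: le_trans (normc_ge0 _) (hm (a + (r%:C)%C) _).
  by rewrite addrC addKr normc_real gtr0_norm.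
rewrite leNgt; apply/negP => mh.
(* On the circle e |z - a|^2 is then half of the gap |h a|^2 - m^2. *)
pose e := (normc (h a) ^+ 2 - m ^+ 2) / (2 * r ^+ 2).
have gap : 0 < normc (h a) ^+ 2 - m ^+ 2.
  by rewrite subr_gt0 ltrXn2r// nnegrE ?normc_ge0.
have e0 : 0 < e by rewrite divr_gt0// mulr_gt0// exprn_gt0.
pose u z := normc (h z) ^+ 2 + e * normc (z - a) ^+ 2.
have cu : {within [set z : R[i] | normc (z - a) <= r], continuous u}.
  apply: continuous_in_subspaceT => z; rewrite inE /= => zr.
  have ch : {for z, continuous (fun z => normc (h z))}.
    apply: continuous_comp; first exact: expand2_continuous (hE z zr).
    exact: normc_continuous.
  have cz := @dist_continuous R a z.
  have csqr (g : R[i] -> R) : {for z, continuous g} ->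
      {for z, continuous (fun z => g z ^+ 2)}.
    by move=> cg; have cgg := cvgM cg cg; exact: cgg.
  have := cvgD (csqr _ ch) (cvgM (cvg_cst e) (csqr _ cz)).
  exact.
have aD : [set z : R[i] | normc (z - a) <= r] a by rewrite /= subrr normc0 ltW.
have [b] := compact_EVT_max (ex_intro _ a aD) cD cu.
rewrite inE /= => br bmax.
have ua : u a = normc (h a) ^+ 2 by rewrite /u subrr normc0 expr0n mulr0 addr0.
have [bE|bne] := eqVneq (normc (b - a)) r.
  have := bmax a; rewrite inE => /(_ aD); rewrite ua /u bE.
  have le1 : normc (h b) ^+ 2 <= m ^+ 2.
    by rewrite lerXn2r ?nnegrE ?normc_ge0// hm.
  have -> : e * r ^+ 2 = (normc (h a) ^+ 2 - m ^+ 2) / 2.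
    by rewrite /e; field; rewrite gt_eqF.
  lra.
have br' : normc (b - a) < r by rewrite lt_neqAle bne.
have [t tr] := @no_local_max h a b e (r - normc (b - a)) e0
  ltac:(by rewrite subr_gt0) (hE b br).
rewrite -/(u b) -/(u (b + t)) ltNge => /negP; apply; apply: bmax; rewrite inE /=.
have -> : b + t - a = (b - a) + t by ring.
by apply: le_trans (normc_triangle _ _) _; rewrite addrC -lerBrDr ltW.
Qed.

End MaximumPrinciple.

(** * Cauchy estimates *)

Section CauchyEstimate.
Variable R : realType.

(** The maximum principle on the disc of radius [r / 2] for the difference quotient
    of [G 0] at a, whose value at a is [G 1 a] and which on the circle is at most
    [2 S / (r / 2)]. *)
Lemma cauchy_derivative (G : nat -> R[i] -> R[i]) (a : R[i]) (r S : R) :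
  0 < r ->
  compact [set z : R[i] | normc (z - a) <= r / 2] ->
  (forall n u, normc (u - a) < r -> is_derive u 1 (G n) (G n.+1 u)) ->
  (forall n, exists B : R, forall u, normc (u - a) < r -> normc (G n u) <= B) ->
  (forall u, normc (u - a) < r -> normc (G 0%N u) <= S) ->
  normc (G 1%N a) <= 4 * S / r.
Proof.
move=> r0 cD dG bG GS.
have r20 : 0 < r / 2 by rewrite divr_gt0.
have near_b b u : normc (b - a) <= r / 2 -> normc (u - b) < r / 2 ->
    normc (u - a) < r.
  move=> ba ub; have -> : u - a = (u - b) + (b - a) by ring.
  by apply: le_lt_trans (normc_triangle _ _) _; lra.
have aa : normc (a - a) <= r / 2 by rewrite subrr normc0 ltW.
have tay N b : normc (b - a) <= r / 2 -> exists2 K : R, 0 <= K & forall t,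
    normc t < r / 2 -> normc (G 0%N (b + t) -
      \sum_(k < N) G k b / k`!%:R * t ^+ k) <= K * normc t ^+ N.
  move=> ba; have [B BP] := bG N; exists B.
    by apply: le_trans (normc_ge0 _) (BP b _); apply: le_lt_trans ba _; lra.
  apply: taylor_normc => [n u|u] ub.
    by apply: dG; exact: near_b ub.
  by apply: BP; exact: near_b ub.
pose h z := if z == a then G 1%N a else (G 0%N z - G 0%N a) / (z - a).
have -> : G 1%N a = h a by rewrite /h eqxx.
apply: (@maximum_principle R h a (r / 2)) => // b br; last first.
  have ba : b != a.
    by apply: contraTneq r20 => E; rewrite -br E subrr normc0 ltxx.
  rewrite /h (negbTE ba) normcM normcV br.
  have -> : 4 * S / r = (2 * S) / (r / 2) by field; rewrite gt_eqF.
  rewrite ler_pM2r ?invr_gt0//.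
  apply: le_trans (normc_triangle _ _) _; rewrite normcN.
  have := GS a; have := GS b; rewrite br subrr normc0 => /(_ _) H1 /(_ r0).
  by have := H1 ltac:(lra); lra.
(* At the centre one order is lost by the division, so the Taylor bound of
   order 4 is needed there. *)
have [ba|ba] := eqVneq b a.
  rewrite {b br}ba; have [K K0 KP] := tay 4%N a aa.
  exists (G 2%N a / 2), (G 3%N a / 6), K => //; exists (r / 2) => // t tr.
  have [->|t0] := eqVneq t 0.
    by rewrite addr0 subrr normc0 !expr0n !mulr0 addr0 subr0 normc0.
  have KPt := KP t tr; rewrite !big_ord_recl big_ord0 /= in KPt.
  have at0 : a + t != a by rewrite -subr_eq0 addrC addKr.
  rewrite /h eqxx (negbTE at0) -(ler_pM2r (_ : 0 < normc t)) ?normc_gt0//.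
  have -> : K * normc t ^+ 3 * normc t = K * normc t ^+ 4 by ring.
  move: KPt; rewrite -normcM; congr (normc _ <= _).
  rewrite !expr0 expr1 fact0 /bump /= !factS fact0.
  have -> : a + t - a = t by ring.
  field. by rewrite t0.
have [K K0 KP] := tay 3%N b br.
pose w := b - a; have w0 : w != 0 by rewrite subr_eq0.
have nw0 : 0 < normc w by rewrite normc_gt0.
(* c1 and c2 solve (H0 + c1 t + c2 t^2) (w + t) = Taylor polynomial - G 0 a,
   up to c2 t^3. *)
pose H0 := h b; pose c1 := (G 1%N b - H0) / w; pose c2 := (G 2%N b / 2 - c1) / w.
exists c1, c2, ((K + normc c2) * 2 / normc w).
  by rewrite !mulr_ge0 ?addr_ge0 ?invr_ge0 ?normc_ge0.
exists (Num.min (r / 2) (normc w / 2)); first by rewrite lt_min r20 divr_gt0.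
move=> t; rewrite lt_min => /andP[tr tw].
have wt : normc w / 2 <= normc (w + t).
  have := normc_triangle (w + t) (- t); rewrite addrK normcN; lra.
have wt0 : w + t != 0 by rewrite -normc_gt0; apply: lt_le_trans wt; rewrite divr_gt0.
have nwt0 : 0 < normc (w + t) by rewrite normc_gt0.
have bta : b + t - a = w + t by rewrite /w; ring.
have btane : b + t != a by rewrite -subr_eq0 bta.
have := KP t tr; rewrite !big_ord_recl big_ord0 /=.
set E := G 0%N (b + t) - _ => EP.
have -> : h (b + t) - h b - (c1 * t + c2 * t ^+ 2) = (E - c2 * t ^+ 3) / (w + t).
  have H0E : G 0%N b = G 0%N a + H0 * w.
    by rewrite /H0 /h (negbTE ba) -/w divfK// addrC subrK.
  rewrite {1}/h (negbTE btane) bta -/H0 /E H0E /bump /= !factS fact0 /c2 /c1.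
  field. by rewrite w0 wt0.
rewrite normcM normcV.
rewrite ler_pdivrMr//.
apply: (@le_trans _ _ ((K + normc c2) * normc t ^+ 3)).
  apply: le_trans (normc_triangle _ _) _; rewrite normcN normcM normcX mulrDl.
  by rewrite lerD2r.
have -> : (K + normc c2) * 2 / normc w * normc t ^+ 3 * normc (w + t) =
  (K + normc c2) * normc t ^+ 3 * (normc (w + t) / (normc w / 2)).
  by field; rewrite gt_eqF.
apply: ler_peMr.
  by rewrite mulr_ge0 ?addr_ge0 ?exprn_ge0 ?normc_ge0.
by rewrite ler_pdivlMr ?mul1r// divr_gt0.
Qed.

End CauchyEstimate.

Section CauchyEstimateCompact.
Variables (R : realType) (X : perfect_compact R).
Implicit Types (f : X -> R[i]) (w z : X).

(** Interior points of X are those where a derivative along X becomes a derivative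
    in the plane, of a function that is defined there. *)
Definition extend0 f (u : R[i]) : R[i] :=
  if pselect ((X : set R[i]) u) is left Xu then f (exist _ u (mem_set Xu)) else 0.

Lemma extend0_val f z : extend0 f (set_val z) = f z.
Proof.
rewrite /extend0; case: pselect => [Xz|/(_ (set_valP z))//].
by congr f; apply: val_inj.
Qed.

Lemma extend0_is_derive f z (l : R[i]) (r : R) : 0 < r ->
  (forall u, normc (u - set_val z) < r -> (X : set R[i]) u) ->
  is_cderiv f z l -> is_derive (set_val z : R[i]) 1 (extend0 f) l.
Proof.
move=> r0 zX /is_cderivE fl; apply/is_derive_normc => e e0.
have [d d0 dP] := fl e e0.
exists (Num.min d r); first by rewrite lt_min d0.
move=> t; rewrite lt_min => /andP[td tr].
have dt : set_val z + t - set_val z = t by rewrite addrC addKr.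
have Xzt : (X : set R[i]) (set_val z + t) by apply: zX; rewrite dt.
pose zt : X := exist _ (set_val z + t) (mem_set Xzt).
have ztE : set_val zt = set_val z + t by [].
have := dP zt; rewrite ztE dt => /(_ td).
by rewrite -(extend0_val f zt) -(extend0_val f z) ztE.
Qed.

Lemma cauchy_derivative_at f w (r S : R) : 0 < r -> csmooth f ->
  (forall u, normc (u - set_val w) < r -> (X : set R[i]) u) ->
  (forall z, normc (set_val z - set_val w) < r -> normc (f z) <= S) ->
  normc (cderiv f w) <= 4 * S / r.
Proof.
move=> r0 sf wX fS.
rewrite -(extend0_val (cderiv f)).
apply: (@cauchy_derivative R (fun n => extend0 (cderivn n f))) => //.
- apply: (subclosed_compact _ (@pc_compact _ X)) => [|u /= uw].
    have cl := @closed_comp R[i] R _ [set s : R | s <= r / 2]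
      (fun u _ => @dist_continuous R (set_val w) u) (@closed_le _ _).
    exact: cl.
  by apply: wX; apply: le_lt_trans uw _; lra.
- move=> n u uw.
  have -> : u = set_val (exist _ u (mem_set (wX u uw)) : X) by [].
  rewrite extend0_val.
  apply: (@extend0_is_derive _ _ _ (r - normc (u - set_val w))).
    by rewrite subr_gt0.
    move=> v; rewrite /set_val /= => vu; apply: wX.
    have -> : v - set_val w = (v - u) + (u - set_val w) by ring.
    by apply: le_lt_trans (normc_triangle _ _) _; rewrite -ltrBrDr.
  exact: csmoothP.
- move=> n; exists (sup_norm (cderivn n f)) => u uw.
  have -> : u = set_val (exist _ u (mem_set (wX u uw)) : X) by [].
  by rewrite extend0_val; exact: le_sup_norm.
- move=> u uw.
  have E : u = set_val (exist _ u (mem_set (wX u uw)) : X) by [].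
  by rewrite {1}E extend0_val; apply: fS.
Qed.

(** Each derivative costs one step of radius s. *)
Lemma cauchy_iterated f (s : R) j w : 0 < s -> csmooth f ->
  (forall u, normc (u - set_val w) < j%:R * s -> (X : set R[i]) u) ->
  normc (cderivn j f w) <= (4 / s) ^+ j * sup_norm f.
Proof.
move=> s0 sf; elim: j w => [|j IH] w wX.
  by rewrite expr0 mul1r; exact: (@le_sup_norm _ _ f 0%N w sf).
have sj : csmooth (cderivn j f).
  by move=> n a; have := sf (n + j)%N a; rewrite /cderivn iterD.
have js : (j.+1)%:R * s = j%:R * s + s :> R by rewrite -addn1 natrD mulrDl mul1r.
rewrite exprS.
have -> : 4 / s * (4 / s) ^+ j * sup_norm f = 4 * ((4 / s) ^+ j * sup_norm f) / s.
  by ring.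
apply: (cauchy_derivative_at s0 sj) => [u us|z zs].
  by apply: wX; rewrite js (lt_le_trans us)// lerDr mulr_ge0// ltW.
apply: IH => u uz; apply: wX.
have -> : u - set_val w = (u - set_val z) + (set_val z - set_val w) by ring.
by apply: le_lt_trans (normc_triangle _ _) _; rewrite js ltrD.
Qed.

(** [k^k <= (2k)! / k! = 'C(2k, k) k!], and a binomial coefficient of [2k] is at most
    [2^(2k)]. *)
Lemma expnn_le_fact k : (k ^ k <= 4 ^ k * k`!)%N.
Proof.
apply: (@leq_trans ('C(k + k, k) * k`!)); last first.
  rewrite leq_mul2r; apply/orP; right.
  rewrite (_ : 4 ^ k = \sum_(i < (k + k).+1) 'C(k + k, i))%N.
    have h : (k < (k + k).+1)%N by rewrite ltnS leq_addr.
    by rewrite (bigD1 (Ordinal h)) //= leq_addr.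
  rewrite (_ : 4 = 2 ^ 2)%N// -expnM mul2n -addnn.
  rewrite -[2%N]/(1 + 1)%N Pascal; apply: eq_bigr => i _.
  by rewrite !exp1n !muln1.
rewrite bin_ffact ffact_prod -[X in (_ ^ X <= _)%N]card_ord -prod_nat_const.
by apply: leq_prod => i _; rewrite -addnBA ?leq_addr// ltnW.
Qed.

(** Iteration with steps [r / k]; the resulting factor [k^k] is geometrically close
    to [k!]. *)
Lemma cauchy_estimate f (r : R) k w : 0 < r -> csmooth f ->
  (forall u, normc (u - set_val w) < r -> (X : set R[i]) u) ->
  normc (cderivn k f w) <= k`!%:R * (16 / r) ^+ k * sup_norm f.
Proof.
move=> r0 sf wX; case: k => [|k].
  by rewrite fact0 mul1r expr0 mul1r; exact: (@le_sup_norm _ _ f 0%N w sf).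
have s0 : 0 < r / k.+1%:R by rewrite divr_gt0.
apply: le_trans (@cauchy_iterated f _ k.+1 w s0 sf _) _.
  by move=> u; rewrite mulrC divfK ?pnatr_eq0//; exact: wX.
rewrite ler_wpM2r ?sup_norm_ge0//.
have -> : 4 / (r / k.+1%:R) = k.+1%:R * (4 / r) :> R.
  by rewrite invf_div; ring.
have -> : 16 / r = 4 * (4 / r) by ring.
have : 0 <= 4 / r by rewrite mulr_ge0// invr_ge0 ltW.
move: (4 / r) => q q0; rewrite !exprMn mulrA ler_wpM2r ?exprn_ge0//.
by rewrite mulrC -!natrX -natrM ler_nat expnn_le_fact.
Qed.

End CauchyEstimateCompact.

(** * Composition of smooth functions *)

Section SmoothFunctions.
Variables (R : realType) (X : perfect_compact R).
Implicit Types (f g h : X -> R[i]) (a z : X).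

(** A coinduction principle: smoothness of a composite cannot be read off a formula
    for its derivatives before they are known to exist. *)
Lemma csmooth_coind (S : set (X -> R[i])) :
  (forall h, S h -> exists2 h', S h' & forall a, is_cderiv h a (h' a)) ->
  forall h, S h -> csmooth h.
Proof.
move=> SS h Sh; have Sn n : S (cderivn n h).
  elim: n => // n /SS[h' Sh' hh'].
  suff -> : cderivn n.+1 h = h' by [].
  by apply/funext => a; have [_ <-] := is_cderivP (hh' a).
by move=> n a; have [h' _ /(_ a) /is_cderivP[]] := SS _ (Sn n).
Qed.

Lemma cderivnSr n f : cderivn n.+1 f = cderivn n (cderiv f).
Proof. by rewrite /cderivn iterSr. Qed.

Lemma csmooth_cderivn f n : csmooth f -> csmooth (cderivn n f).
Proof. by move=> sf k a; have := sf (k + n)%N a; rewrite /cderivn iterD. Qed.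

Lemma csmooth_cderiv f : csmooth f -> csmooth (cderiv f).
Proof. exact: (@csmooth_cderivn f 1). Qed.

End SmoothFunctions.

Lemma coefX_ge0 (R : numDomainType) (y : {poly R}) k n :
  (forall i, 0 <= y`_i) -> 0 <= (y ^+ k)`_n.
Proof.
move=> y0; elim: k n => [|k IH] n; first by rewrite expr0 coefC; case: eqP.
by rewrite exprS coefM sumr_ge0// => i _; rewrite mulr_ge0.
Qed.

Section Composition.
Variables (R : realType) (X Y : perfect_compact R) (phi : X -> Y).
Implicit Types (f : Y -> R[i]) (g : X -> R[i]) (a z : X).

Let psi : X -> R[i] := set_val \o phi.

Lemma is_cderiv_comp f a (l m : R[i]) :
  is_cderiv f (phi a) l -> is_cderiv psi a m -> is_cderiv (f \o phi) a (l * m).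
Proof.
move=> /is_cderivE fl /is_cderivE pm; apply/is_cderivE => e e0.
pose A := normc m + 1; pose B := normc l + A.
have A0 : 0 < A by rewrite ltr_wpDl// normc_ge0.
have B0 : 0 < B by rewrite ltr_wpDl// normc_ge0.
pose e' := Num.min 1 (e / B).
have e'0 : 0 < e' by rewrite lt_min ltr01 divr_gt0.
have e'1 : e' <= 1 by rewrite ge_min lexx.
have e'B : e' * B <= e by rewrite -ler_pdivlMr// ge_min lexx orbT.
have [d d0 dP] := fl e' e'0; have [d' d'0 d'P] := pm e' e'0.
exists (Num.min d' (d / A)); first by rewrite lt_min d'0 divr_gt0.
move=> z; rewrite lt_min ltr_pdivlMr// => /andP[zd' zd].
set t := set_val z - set_val a in zd' zd *.
have pz := d'P z zd'; rewrite -/t in pz.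
have t0 : 0 <= normc t := normc_ge0 t.
have lip : normc (psi z - psi a) <= A * normc t.
  rewrite -[psi z - psi a](subrK (m * t)).
  apply: le_trans (normc_triangle _ _) _; rewrite normcM /A mulrDl mul1r addrC.
  by rewrite lerD2l; apply: le_trans pz _; rewrite ler_piMl.
have fz := dP (phi z) ltac:(by apply: le_lt_trans lip _; rewrite mulrC).
have -> : (f \o phi) z - (f \o phi) a - l * m * t =
    (f (phi z) - f (phi a) - l * (psi z - psi a)) + l * (psi z - psi a - m * t).
  by rewrite /=; ring.
apply: le_trans (normc_triangle _ _) _; rewrite normcM.
apply: (@le_trans _ _ (e' * (A * normc t) + normc l * (e' * normc t))).
  apply: lerD; last by rewrite ler_wpM2l// normc_ge0.
  by apply: le_trans fz _; rewrite ler_wpM2l// ltW.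
have -> : e' * (A * normc t) + normc l * (e' * normc t) = e' * B * normc t.
  by rewrite /B; ring.
by rewrite ler_wpM2r.
Qed.

Hypothesis psi_smooth : csmooth psi.

(** The finite sums of products [(f \o phi) * g], with f and g smooth, are stable
    under differentiation. *)
Lemma csmooth_comp f : csmooth f -> csmooth (f \o phi).
Proof.
move=> sf.
pose term (p : (Y -> R[i]) * (X -> R[i])) : X -> R[i] := (p.1 \o phi) * p.2.
pose S := [set h | exists2 s : seq ((Y -> R[i]) * (X -> R[i])),
  (forall p, List.In p s -> csmooth p.1 /\ csmooth p.2) & h = \sum_(p <- s) term p].
suff SS : forall h, S h -> exists2 h', S h' & forall a, is_cderiv h a (h' a).
  apply: (csmooth_coind SS); exists [:: (f, fun=> 1)].
    by move=> p [<-|[]]; split; [exact: sf|exact: (csmooth_cst X 1).1].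
  by rewrite big_seq1 /term mulr1.
move=> _ [s + ->]; elim: s => [|[f0 g0] s IH] sP.
  exists 0; last by move=> a; rewrite big_nil; exact: is_cderiv_cst.
  by exists [::] => //; rewrite big_nil.
have [h' [s' s'P ->] h'd] := IH (fun p ps => sP p (or_intror ps)).
have [/= sf0 sg0] := sP (f0, g0) (or_introl erefl).
exists (term (cderiv f0, cderiv psi * g0) + term (f0, cderiv g0) +
   \sum_(p <- s') term p).
  exists ((cderiv f0, cderiv psi * g0) :: (f0, cderiv g0) :: s').
    move=> p [<-|[<-|ps']] /=; last exact: s'P.
      split; first exact: (csmooth_cderiv sf0).
      exact: (csmoothM (csmooth_cderiv psi_smooth) sg0).1.
    by split; [exact: sf0|exact: (csmooth_cderiv sg0)].
  by rewrite !big_cons addrA.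
move=> a; rewrite big_cons; apply: is_cderivD (h'd a).
have := is_cderivM (is_cderiv_comp (@csmoothP _ _ f0 0 (phi a) sf0)
    (@csmoothP _ _ psi 0 a psi_smooth))
  (@csmoothP _ _ g0 0 a sg0).
by rewrite /term /= !fctE mulrA.
Qed.

Lemma cderiv_comp f : csmooth f ->
  cderiv (f \o phi) = (cderiv f \o phi) * cderiv psi.
Proof.
move=> sf; apply/funext => a.
by have [_ ->] := is_cderivP
  (is_cderiv_comp (@csmoothP _ _ f 0 (phi a) sf) (@csmoothP _ _ psi 0 a psi_smooth)).
Qed.

(** Induction on n, for all f at once.  Leibniz's rule applied to
    [(f' \o phi) * phi'] is the coefficientwise form of the identity
    [(y^(k+1))' = (k+1) y^k y'], so the coefficients of [y^k] stand for Bell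
    polynomials without these being introduced. *)
Lemma faa_di_bruno_le (y : {poly R}) (N : nat) z :
  (forall i, 0 <= y`_i) ->
  (forall j, (j < N)%N -> normc (cderivn j.+1 psi z) <= (j.+1)`!%:R * y`_j.+1) ->
  forall n f, (n <= N)%N -> csmooth f ->
  normc (cderivn n (f \o phi) z) <=
    n`!%:R * \sum_(k < n.+1) normc (cderivn k f (phi z)) / k`!%:R * (y ^+ k)`_n.
Proof.
move=> y0 yP.
have yX0 k n : 0 <= (y ^+ k)`_n by exact: coefX_ge0.
have y'0 n : 0 <= y^`()`_n by rewrite coef_deriv mulrn_wge0.
elim/ltn_ind => -[_ f _ _|n IH f nN sf].
  by rewrite big_ord1 fact0 mul1r invr1 mulr1 expr0 coefC eqxx mulr1.
have sf' := csmooth_cderiv sf; have sp' := csmooth_cderiv psi_smooth.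
have sc := csmooth_comp sf'.
rewrite cderivnSr cderiv_comp// (csmoothM sc sp').2.
apply: le_trans (normc_sum _ _ _) _.
pose a k := normc (cderivn k f (phi z)).
have a0 k : 0 <= a k by exact: normc_ge0.
have step i : (i <= n)%N ->
    normc (cderivn i (cderiv f \o phi) z * cderivn (n - i) (cderiv psi) z *+ 'C(n, i))
    <= n`!%:R * \sum_(k < n.+1) a k.+1 / k`!%:R * ((y ^+ k)`_i * y^`()`_(n - i)).
  move=> le_in; rewrite normcMn normcM.
  have -> : n`!%:R = 'C(n, i)%:R * (i`!%:R * (n - i)`!%:R) :> R.
    by rewrite -!natrM bin_fact.
  rewrite -[leLHS]mulr_natl -[leRHS]mulrA ler_wpM2l//.
  have -> : i`!%:R * (n - i)`!%:R * (\sum_(k < n.+1) a k.+1 / k`!%:R *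
       ((y ^+ k)`_i * y^`()`_(n - i))) =
     (i`!%:R * (\sum_(k < n.+1) a k.+1 / k`!%:R * (y ^+ k)`_i)) *
     ((n - i)`!%:R * y^`()`_(n - i)).
    rewrite mulrACA; congr (_ * _); rewrite mulr_suml.
    by apply: eq_bigr => k _; rewrite mulrA.
  apply: ler_pM; rewrite ?normc_ge0//.
    have := IH i ltac:(by rewrite ltnS) _ (leq_trans le_in (ltnW nN)) sf'.
    move/le_trans; apply; rewrite ler_wpM2l//.
    rewrite (big_ord_widen n.+1 (fun k =>
      normc (cderivn k (cderiv f) (phi z)) / k`!%:R * (y ^+ k)`_i))//.
    rewrite big_mkcond /=.
    apply: ler_sum => k _; rewrite /a cderivnSr; case: ifP => // _.
    by rewrite !mulr_ge0 ?normc_ge0 ?invr_ge0.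
  rewrite -cderivnSr coef_deriv; apply: le_trans (yP _ _) _.
    by apply: leq_ltn_trans nN; exact: leq_subr.
  by rewrite factS natrM -[X in _ <= _ * X]mulr_natl mulrA [X in _ <= X * _]mulrC.
apply: (@le_trans _ _ (\sum_(i < n.+1) n`!%:R * \sum_(k < n.+1) a k.+1 / k`!%:R *
      ((y ^+ k)`_i * y^`()`_(n - i)))).
  by apply: ler_sum => i _; apply: step; rewrite -ltnS.
rewrite -mulr_sumr exchange_big /= [X in _ <= _ * X]big_ord_recl /= fact0.
rewrite expr0 coefC /= mulr0 add0r factS natrM (mulrC n.+1%:R) -mulrA ler_wpM2l// mulr_sumr.
apply: ler_sum => k _; rewrite /bump add1n -/(a k.+1) -mulr_sumr.
have E : \sum_(i < n.+1) (y ^+ k)`_i * y^`()`_(n - i) = (y ^+ k * y^`())`_n.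
  by rewrite coefM.
rewrite E.
(* The coefficient of t^n in (y^(k+1))' = (k+1) y^k y'. *)
have D : (y ^+ k.+1)`_n.+1 * n.+1%:R = k.+1%:R * (y ^+ k * y^`())`_n.
  by rewrite mulr_natr -coef_deriv deriv_exp coefMn mulr_natl mulrC.
rewrite [leRHS]mulrC -[leRHS]mulrA D factS natrM.
rewrite [leRHS](_ : _ = a k.+1 / k`!%:R * (y ^+ k * y^`())`_n)//.
have k1 : k.+1%:R != 0 :> R by rewrite pnatr_eq0.
by rewrite mulrA (mulrC k.+1%:R) invfM !mulrA divfK.
Qed.

End Composition.

(** * Majorants and weights *)

Section Majorants.
Variable R : realType.
Implicit Types (p : {poly R}) (x C rho : R).

Lemma geometric_half_le x N : 0 <= x -> x <= 1 / 2 -> \sum_(i < N) x ^+ i <= 2.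
Proof.
move=> x0 x12; elim: N => [|N IH]; first by rewrite big_ord0.
rewrite big_ord_recl expr0 /=; under eq_bigr do rewrite /bump add1n exprS.
rewrite -mulr_sumr; apply: (@le_trans _ _ (1 + 1 / 2 * 2)); last by lra.
rewrite lerD2l; apply: ler_pM => //.
by rewrite sumr_ge0// => i _; rewrite exprn_ge0.
Qed.

Lemma le_horner p x N : 0 <= x -> (forall i, 0 <= p`_i) ->
  \sum_(n < N) p`_n * x ^+ n <= p.[x].
Proof.
move=> x0 p0; rewrite (@horner_coef_wide _ (maxn N (size p))) ?leq_maxr//.
rewrite (big_ord_widen (maxn N (size p)) (fun n => p`_n * x ^+ n)) ?leq_maxl//.
rewrite big_mkcond /=; apply: ler_sum => i _; case: ifP => // _.
by rewrite mulr_ge0// exprn_ge0.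
Qed.

(** [rho t + C^2 t^2 + ... + C^N t^N]: the linear coefficient is kept apart because
    only [|phi'|] is known to be less than 1. *)
Definition majorant rho C (N : nat) : {poly R} :=
  \poly_(j < N.+1) (match j with 0%N => 0 | 1%N => rho | _ => C ^+ j end).

Lemma majorant_ge0 rho C N i : 0 <= rho -> 0 <= C -> 0 <= (majorant rho C N)`_i.
Proof.
move=> rho0 C0; rewrite coef_poly; case: ifP => // _.
by case: i => [|[|i]] //; rewrite exprn_ge0.
Qed.

Lemma majorant_horner_le rho C N x : 0 <= rho -> 0 <= C -> 0 <= x ->
  C * x <= 1 / 2 -> (majorant rho C N).[x] <= (rho + 2 * C ^+ 2 * x) * x.
Proof.
move=> rho0 C0 x0 Cx; rewrite horner_poly.
have rhs0 : 0 <= 2 * C ^+ 2 * x * x by rewrite !mulr_ge0// exprn_ge0.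
rewrite big_ord_recl mul0r add0r.
case: N => [|N]; first by rewrite big_ord0 mulr_ge0// addr_ge0// !mulr_ge0 ?exprn_ge0.
rewrite big_ord_recl /= expr1 mulrDl lerD2l.
under eq_bigr => i _ do rewrite /bump !add1n -exprMn (_ : i.+2 = (2 + i)%N)// exprD.
rewrite -mulr_sumr.
have -> : 2 * C ^+ 2 * x * x = (C * x) ^+ 2 * 2 by ring.
by rewrite ler_wpM2l ?exprn_ge0 ?mulr_ge0// geometric_half_le// mulr_ge0.
Qed.

End Majorants.

Section Weights.
Variables (R : realType) (M : weight_sequence R).

Lemma root_le_expr (t C : R) (k : nat) : 0 <= t -> (0 < k)%N ->
  t `^ k%:R^-1 <= C -> t <= C ^+ k.
Proof.
move=> t0 k0 tC.
have -> : t = (t `^ k%:R^-1) ^+ k.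
  rewrite -powR_mulrn ?powR_ge0// -powRrM mulVf ?powRr1//.
  by rewrite pnatr_eq0 -lt0n.
by rewrite lerXn2r ?nnegrE ?powR_ge0// (le_trans _ tC)// powR_ge0.
Qed.

(** [n! / M_n <= e^n] for large n; the constant takes care of the other n. *)
Lemma non_analytic_geometric (e : R) : non_analytic M -> 0 < e ->
  exists2 K : R, 0 < K & forall n, n`!%:R / M n <= K * e ^+ n.
Proof.
move=> naM e0.
have w0 n : 0 <= n`!%:R / M n by rewrite divr_ge0// ltW// weight_gt0.
move/cvgrPdist_le/(_ e e0): naM => [n0 _ n0P].
(* Each of the first terms of the sum alone suffices for its own index. *)
pose K := 1 + \sum_(i < n0.+1) (i`!%:R / M i) / e ^+ i.
have s0 (P : pred 'I_n0.+1) : 0 <= \sum_(i < n0.+1 | P i) (i`!%:R / M i) / e ^+ i.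
  by rewrite sumr_ge0// => i _; rewrite mulr_ge0// invr_ge0 exprn_ge0// ltW.
exists K; first by rewrite ltr_pwDl// s0.
move=> n; have [nn0|n0n] := ltnP n n0.+1.
  rewrite -ler_pdivrMr ?exprn_gt0// /K (bigD1 (Ordinal nn0))//=.
  by rewrite addrCA lerDl addr_ge0.
have : n`!%:R / M n <= e ^+ n.
  apply: root_le_expr => //; first by apply: leq_ltn_trans n0n.
  have := n0P n (ltnW n0n); rewrite /= sub0r normrN ger0_norm ?powR_ge0//.
move/le_trans; apply; apply: ler_peMl; first by rewrite exprn_ge0// ltW.
by rewrite /K lerDl s0.
Qed.

Lemma weight_ratio_le k n : (k <= n)%N ->
  n`!%:R / M n * (M k / k`!%:R) <= (n - k)`!%:R / M (n - k)%N.
Proof.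
move=> kn.
have Mk := weight_gt0 M k; have Mn := weight_gt0 M n.
have Mnk := weight_gt0 M (n - k)%N.
have fk : 0 < k`!%:R :> R by rewrite ltr0n fact_gt0.
have := weight_binomial M (n - k) k; rewrite subnKC// => wb.
have -> : n`!%:R = 'C(n, k)%:R * (k`!%:R * (n - k)`!%:R) :> R.
  by rewrite -!natrM bin_fact.
have -> : 'C(n, k)%:R * (k`!%:R * (n - k)`!%:R) / M n * (M k / k`!%:R) =
   'C(n, k)%:R * (M k * M (n - k)%N / M n) * ((n - k)`!%:R / M (n - k)%N).
  by field; rewrite !gt_eqF.
apply: ler_piMl; first by rewrite divr_ge0// ltW.
by rewrite mulrA ler_pdivrMr// mul1r -ler_pdivlMr// mulr_gt0.
Qed.

(** Exchange of the two sums: for fixed k the weights leave [K e^(n-k)], and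
    [\sum_n (p^k)_n e^(n-k)] is at most [(p(e) / e)^k]. *)
Lemma majorant_sum_le (p : {poly R}) (e K q : R) (A : nat -> R) N :
  0 < e -> (forall n, n`!%:R / M n <= K * e ^+ n) ->
  (forall i, 0 <= p`_i) -> p.[e] <= q * e -> (forall k, 0 <= A k) ->
  \sum_(n < N) n`!%:R / M n * \sum_(k < n.+1) A k / k`!%:R * (p ^+ k)`_n <=
  \sum_(k < N) K * q ^+ k * (A k / M k).
Proof.
move=> e0 Kw p0 pe A0.
have pX0 k i : 0 <= (p ^+ k)`_i by exact: coefX_ge0.
pose F (n k : nat) := (n`!%:R / M n) * (A k / k`!%:R * (p ^+ k)`_n).
have -> : \sum_(n < N) n`!%:R / M n * \sum_(k < n.+1) A k / k`!%:R * (p ^+ k)`_n =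
    \sum_(n < N) \sum_(k < N | (k <= n)%N) F n k.
  apply: eq_bigr => n _; rewrite mulr_sumr.
  by rewrite (big_ord_widen N (fun k => F n k)).
have K0 : 0 <= K.
  by have := Kw 0%N; rewrite expr0 mulr1; apply: le_trans; rewrite divr_ge0// ltW// weight_gt0.
rewrite (exchange_big_dep predT) //=; apply: ler_sum => k _.
apply: (@le_trans _ _ (\sum_(n < N | (k <= n)%N)
    (A k / M k) * (K / e ^+ k) * ((p ^+ k)`_n * e ^+ n))).
  apply: ler_sum => n kn.
  have -> : F n k = (A k / M k) * (p ^+ k)`_n *
      (n`!%:R / M n * (M k / k`!%:R)).
    have Mk := weight_gt0 M k; have Mn := weight_gt0 M n.
    rewrite /F; field; rewrite !gt_eqF ?ltr0n ?fact_gt0//.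
  have -> : A k / M k * (K / e ^+ k) * ((p ^+ k)`_n * e ^+ n) =
      A k / M k * (p ^+ k)`_n * (K * (e ^+ n / e ^+ k)) by ring.
  apply: ler_wpM2l; first by rewrite !mulr_ge0// invr_ge0 ltW// weight_gt0.
  rewrite -expfB_cond ?gt_eqF//.
  exact: le_trans (weight_ratio_le kn) (Kw _).
rewrite -mulr_sumr.
have -> : K * q ^+ k * (A k / M k) = A k / M k * (K / e ^+ k) * (q * e) ^+ k.
  by rewrite exprMn; field; rewrite !gt_eqF ?weight_gt0 ?exprn_gt0.
apply: ler_wpM2l.
  by rewrite !mulr_ge0// ?invr_ge0 ?exprn_ge0 ?ltW ?weight_gt0.
apply: (@le_trans _ _ (p ^+ k).[e]).
  apply: le_trans (le_horner N (ltW e0) (pX0 k)).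
  rewrite big_mkcond /=; apply: ler_sum => n _; case: ifP => // _.
  by rewrite mulr_ge0// exprn_ge0// ltW.
rewrite horner_exp lerXn2r// ?nnegrE.
  apply: le_trans (le_horner 0 (ltW e0) p0); by rewrite big_ord0.
by apply: le_trans pe; apply: le_trans (le_horner 0 (ltW e0) p0); rewrite big_ord0.
Qed.

End Weights.

(** * The estimate for composition *)

Section MainEstimate.
Variables (R : realType) (X Y : perfect_compact R).
Variables (M : weight_sequence R) (phi : X -> Y).
Implicit Types (f : Y -> R[i]) (z : X).

Let psi : X -> R[i] := set_val \o phi.

Hypothesis naM : non_analytic M.
Hypothesis psi_analytic : analytic_map psi.

Lemma analytic_bound : exists2 C : R, 0 < C & forall k, (0 < k)%N ->
  sup_norm (cderivn k psi) <= k`!%:R * C ^+ k.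
Proof.
have [_ [C0 C0P]] := psi_analytic.
exists (`|C0| + 1) => [|k k0]; first by rewrite ltr_pwDr.
have fk : 0 < k`!%:R :> R by rewrite ltr0n fact_gt0.
rewrite mulrC -ler_pdivrMr//; apply: root_le_expr => //.
  by rewrite divr_ge0 ?sup_norm_ge0// ltW.
apply: (@le_trans _ _ C0); first by apply: C0P; exists k.
by apply: le_trans (ler_norm _) _; rewrite lerDl.
Qed.

Let psi_smooth : csmooth psi := psi_analytic.1.

Hypothesis X_cover : [set: X] = [set z : X | `|cderiv psi z| < 1] `|`
       phi @^-1` (set_val @^-1` (Y : set R[i])°).

(** For each point the condition holds nearby with a smaller e; compactness of X
    makes e uniform. *)
Lemma uniform_cover : exists2 e : R, 0 < e < 1 & forall z : X,
  normc (cderiv psi z) <= 1 - e \/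
  (forall u, normc (u - psi z) < e -> (Y : set R[i]) u).
Proof.
pose P (e : R) z := normc (cderiv psi z) <= 1 - e \/
  (forall u, normc (u - psi z) < e -> (Y : set R[i]) u).
have splitC (a b c : R[i]) : a = (a - b - c) + (b + c) by ring.
have H : forall z, [set: X] z -> \forall z' \near z & e \near (0 : R)^'+, P e z'.
  move=> z; rewrite X_cover => -[/= z1|/= /nbhs_normcP[d d0 dY]].
    have {}z1 : normc (cderiv psi z) < 1 by rewrite -ltcR -normC_normc.
    pose e := (1 - normc (cderiv psi z)) / 2.
    have e0 : 0 < e by rewrite divr_gt0// subr_gt0.
    have /is_cderivE/(_ 1 ltr01)[d d0 dP] := @csmoothP _ _ psi 1 z psi_smooth.
    pose A := 1 + normc (cderivn 2 psi z).
    have A0 : 0 < A by rewrite ltr_pwDl// normc_ge0.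
    exists ([set z' : X | normc (set_val z' - set_val z) < Num.min d (e / A)],
            [set e' : R | e' < e]) => /=.
      split; last exact: nbhs_right_lt.
      apply/nbhs_set_valP; exists (Num.min d (e / A)) => //.
      by rewrite lt_min d0 divr_gt0.
    move=> [z' e'] /= [zz' e'e]; left; move: zz'; rewrite lt_min => /andP[zd ze].
    have := dP z' zd; rewrite mul1r; set t := set_val z' - set_val z in zd ze *.
    rewrite [cderivn 1 psi]/(cderivn _ _) /= => h.
    have l1 : normc (cderiv psi z') <= normc (cderiv psi z) + A * normc t.
      rewrite [cderiv psi z'](splitC _ (cderiv psi z) (cderivn 2 psi z * t)).
      apply: le_trans (normc_triangle _ _) _.
      have := normc_triangle (cderiv psi z) (cderivn 2 psi z * t).
      by rewrite normcM /A mulrDl mul1r; move: h; lra.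
    have l2 : A * normc t < e by rewrite mulrC -ltr_pdivlMr.
    apply: le_trans l1 _; move: l2 e'e; rewrite /e; lra.
  have /is_cderivE/(_ 1 ltr01)[d' d'0 dP] := @csmoothP _ _ psi 0 z psi_smooth.
  pose A := 1 + normc (cderiv psi z).
  have A0 : 0 < A by rewrite ltr_pwDl// normc_ge0.
  exists ([set z' : X | normc (set_val z' - set_val z) < Num.min d' (d / 2 / A)],
            [set e' : R | e' < d / 2]) => /=.
    split; last by apply: nbhs_right_lt; rewrite divr_gt0.
    apply/nbhs_set_valP; exists (Num.min d' (d / 2 / A)) => //.
    by rewrite lt_min d'0 !divr_gt0.
  move=> [z' e'] /= [zz' e'e]; right; move: zz'; rewrite lt_min => /andP[zd ze].
  have := dP z' zd; rewrite mul1r; set t := set_val z' - set_val z in zd ze *.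
  move=> h u ue; apply: dY.
  have l2 : A * normc t < d / 2 by rewrite mulrC -ltr_pdivlMr.
  have -> : u - set_val (phi z) = (u - psi z') +
    ((psi z' - psi z - cderiv psi z * t) + cderiv psi z * t).
    by rewrite subrK addrA subrK.
  apply: le_lt_trans (normc_triangle _ _) _.
  have := normc_triangle (psi z' - psi z - cderiv psi z * t) (cderiv psi z * t).
  move: h l2; rewrite normcM /A mulrDl mul1r /=; move: ue e'e; lra.
have := (compact_near_coveringP _).1 (@set_val_compact _ X) R _ P _ H.
move=> near0; have pos := nbhs_right_gt (0 : R).
have lt1 := nbhs_right_lt (ltr01 : 0 < 1 :> R).
have : \forall e \near (0 : R)^'+, [set: X] `<=` P e /\ (0 < e /\ e < 1).
  by apply: filterI; [exact: near0|exact: filterI].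
move=> /(@filter_ex _ _ (at_right_proper_filter 0))[e [eP [e0 e1]]].
exists e; first by apply/andP; split.
by move=> z; exact: eP.
Qed.

(** The polynomial [majorant rho C N] dominates the Taylor coefficients of phi at z up
    to order N. *)
Lemma cderivn_comp_majorant (C rho : R) N n f z :
  0 <= rho -> 0 <= C -> (forall k, (0 < k)%N ->
    sup_norm (cderivn k psi) <= k`!%:R * C ^+ k) ->
  normc (cderiv psi z) <= rho -> (n <= N)%N -> csmooth f ->
  normc (cderivn n (f \o phi) z) <= n`!%:R *
    \sum_(k < n.+1) normc (cderivn k f (phi z)) / k`!%:R *
      (majorant rho C N ^+ k)`_n.
Proof.
move=> rho0 C0 CP zrho nN sf.
apply: (@faa_di_bruno_le _ _ _ _ psi_smooth _ N) => // [i|j jN].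
  exact: majorant_ge0.
rewrite coef_poly ltnS jN; case: j jN => [_|j jN].
  by rewrite (_ : 1`!%:R = 1 :> R)// mul1r.
by apply: le_trans (CP _ _) => //; exact: le_sup_norm.
Qed.

(** The factor [q^k], on the one hand, and the absence of derivatives in the last
    term, on the other, are what makes the composition operator compact. *)
Theorem composition_estimate : exists q K K' : R, [/\ 0 <= q < 1, 0 <= K, 0 <= K' &
  forall f, csmooth f -> forall N,
  \sum_(n < N) dd_term M (f \o phi) n <=
  \sum_(k < N) K * q ^+ k * dd_term M f k + K' * sup_norm f].
Proof.
have [C C0 CP] := analytic_bound.
have [e /andP[e0 e1] eP] := uniform_cover.
(* Where |phi'| <= rho: x1 is so small that y(x1) / x1 <= rho + e / 2 = q for
   the majorant y. *)
pose rho := 1 - e.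
have rho0 : 0 <= rho by rewrite subr_ge0 ltW.
pose x1 := Num.min (1 / 2 / C) (e / 2 / (2 * C ^+ 2)).
have CC0 : 0 < 2 * C ^+ 2 by rewrite mulr_gt0// exprn_gt0.
have x10 : 0 < x1 by rewrite lt_min !divr_gt0.
have Cx1 : C * x1 <= 1 / 2 by rewrite mulrC -ler_pdivlMr// ge_min lexx.
have CCx1 : 2 * C ^+ 2 * x1 <= e / 2.
  by rewrite mulrC -ler_pdivlMr// ge_min lexx orbT.
have [K1 K10 K1P] := non_analytic_geometric naM x10.
pose q := 1 - e / 2.
(* Where phi z is inside Y: Cauchy's estimate has ratio D there, and x2 is such
   that D y(x2) <= 1 / 2; the weights then beat x2^(-n) because they are
   compared with (x2 / 2)^n. *)
have [D D0 DE] : exists2 D : R, 0 < D & D = 16 / e.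
  by exists (16 / e) => //; rewrite divr_gt0.
pose x2 := Num.min (1 / 2 / C) (1 / 2 / (2 * C * D)).
have CD0 : 0 < 2 * C * D by rewrite !mulr_gt0.
have x20 : 0 < x2 by rewrite lt_min !divr_gt0.
have Cx2 : C * x2 <= 1 / 2 by rewrite mulrC -ler_pdivlMr// ge_min lexx.
have CDx2 : 2 * C * D * x2 <= 1 / 2.
  by rewrite mulrC -ler_pdivlMr// ge_min lexx orbT.
have x220 : 0 < x2 / 2 by rewrite divr_gt0.
have [K2 K20 K2P] := non_analytic_geometric naM x220.
exists q, K1, (4 * K2); split.
- by rewrite /q; apply/andP; split; lra.
- exact: ltW.
- by rewrite mulr_ge0// ltW.
move=> f sf N; pose S := sup_norm f.
have S0 : 0 <= S by exact: sup_norm_ge0.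
pose y1 := majorant rho C N; pose y2 := majorant C C N.
have y10 i : 0 <= y1`_i by apply: majorant_ge0 => //; exact: ltW.
have y20 i : 0 <= y2`_i by apply: majorant_ge0 => //; exact: ltW.
(* B1 and B2 bound the two kinds of points; being nonnegative, their sum bounds
   both, hence the supremum over X. *)
pose B1 n := \sum_(k < n.+1) sup_norm (cderivn k f) / k`!%:R * (y1 ^+ k)`_n.
pose B2 n := \sum_(k < n.+1) D ^+ k * S * (y2 ^+ k)`_n.
have B10 n : 0 <= B1 n.
  apply: sumr_ge0 => k _; rewrite mulr_ge0 ?coefX_ge0// divr_ge0 ?sup_norm_ge0//.
have B20 n : 0 <= B2 n.
  by apply: sumr_ge0 => k _; rewrite mulr_ge0 ?coefX_ge0// mulr_ge0// exprn_ge0// ltW.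
have dB n : (n < N)%N -> sup_norm (cderivn n (f \o phi)) <= n`!%:R * (B1 n + B2 n).
  move=> nN; apply: sup_norm_le => [|z]; first by rewrite mulr_ge0// addr_ge0.
  have [zc|zi] := eP z.
    apply: le_trans (@cderivn_comp_majorant C rho N n f z _ _ CP zc (ltnW nN) sf) _ => //.
      exact: ltW.
    rewrite ler_wpM2l// ler_wpDr// /B1; apply: ler_sum => k _.
    rewrite ler_wpM2r ?coefX_ge0// ler_wpM2r ?invr_ge0//; exact: le_sup_norm.
  have zC : normc (cderiv psi z) <= C.
    have := CP 1%N isT; rewrite (_ : 1`!%:R = 1 :> R)// mul1r expr1; apply: le_trans.
    exact: (@le_sup_norm _ _ psi 1 z psi_smooth).
  apply: le_trans (@cderivn_comp_majorant C C N n f z _ _ CP zC (ltnW nN) sf) _.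
  - exact: ltW.
  - exact: ltW.
  rewrite ler_wpM2l// ler_wpDl// /B2; apply: ler_sum => k _.
  rewrite ler_wpM2r ?coefX_ge0// ler_pdivrMr ?ltr0n ?fact_gt0//.
  by apply: le_trans (cauchy_estimate k e0 sf zi) _; rewrite -DE [leRHS]mulrC mulrA.
have part1 : \sum_(n < N) n`!%:R / M n * B1 n <=
    \sum_(k < N) K1 * q ^+ k * dd_term M f k.
  apply: (@majorant_sum_le _ M y1 x1 K1 q (fun k => sup_norm (cderivn k f))) => //.
    apply: le_trans (majorant_horner_le N rho0 (ltW C0) (ltW x10) Cx1) _.
    by rewrite ler_pM2r// /rho /q; move: CCx1; lra.
  by move=> k; exact: sup_norm_ge0.
have B2x n : B2 n * x2 ^+ n <= 2 * S.
  apply: (@le_trans _ _ (\sum_(k < n.+1) S * (1 / 2) ^+ k)); last first.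
    rewrite -mulr_sumr mulrC ler_wpM2r// geometric_half_le//.
  rewrite mulr_suml; apply: ler_sum => k _.
  have yk : (y2 ^+ k)`_n * x2 ^+ n <= (2 * C * x2) ^+ k.
    apply: (@le_trans _ _ (y2 ^+ k).[x2]).
      apply: le_trans (le_horner n.+1 (ltW x20) (fun i => coefX_ge0 k i y20)).
      rewrite big_ord_recr /= lerDr sumr_ge0// => i _.
      by rewrite mulr_ge0 ?coefX_ge0// exprn_ge0// ltW.
    have h0 : 0 <= y2.[x2].
      by apply: le_trans (le_horner 0 (ltW x20) y20); rewrite big_ord0.
    have h1 : 0 <= 2 * C * x2 by rewrite !mulr_ge0// ltW.
    rewrite horner_exp lerXn2r//.
    apply: le_trans (majorant_horner_le N (ltW C0) (ltW C0) (ltW x20) Cx2) _.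
    rewrite ler_pM2r//.
    have -> : 2 * C ^+ 2 * x2 = C * (2 * (C * x2)) by ring.
    have : C * (2 * (C * x2)) <= C * 1 by rewrite ler_pM2l//; move: Cx2; lra.
    lra.
  have -> : D ^+ k * S * (y2 ^+ k)`_n * x2 ^+ n = S * (D ^+ k * ((y2 ^+ k)`_n * x2 ^+ n)).
    by ring.
  rewrite ler_wpM2l//; apply: (@le_trans _ _ (D ^+ k * (2 * C * x2) ^+ k)).
    by rewrite ler_wpM2l// exprn_ge0// ltW.
  have h2 : 0 <= D * (2 * C * x2) by rewrite !mulr_ge0// ltW.
  rewrite -exprMn lerXn2r//; first by rewrite nnegrE; lra.
  by rewrite (le_trans _ CDx2)// le_eqVlt; apply/orP; left; apply/eqP; ring.
have part2 : \sum_(n < N) n`!%:R / M n * B2 n <= 4 * K2 * S.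
  apply: (@le_trans _ _ (\sum_(n < N) (2 * K2 * S) * (1 / 2) ^+ n)).
    apply: ler_sum => n _.
    apply: (@le_trans _ _ (K2 * (x2 / 2) ^+ n * B2 n)).
      by rewrite ler_wpM2r.
    have -> : K2 * (x2 / 2) ^+ n * B2 n = K2 * (1 / 2) ^+ n * (B2 n * x2 ^+ n).
      by rewrite div1r exprMn; ring.
    have -> : 2 * K2 * S * (1 / 2) ^+ n = K2 * (1 / 2) ^+ n * (2 * S) by ring.
    by rewrite ler_wpM2l// mulr_ge0// ?exprn_ge0// ltW.
  rewrite -mulr_sumr.
  have -> : 4 * K2 * S = 2 * K2 * S * 2 by ring.
  by rewrite ler_wpM2l ?geometric_half_le// !mulr_ge0// ltW.
apply: le_trans (lerD part1 part2); rewrite -big_split /=.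
apply: ler_sum => n _; rewrite /dd_term ler_pdivrMr ?weight_gt0//.
apply: le_trans (dB n (ltn_ord n)) _.
rewrite le_eqVlt; apply/orP; left; apply/eqP.
by field; rewrite gt_eqF// weight_gt0.
Qed.

End MainEstimate.

(** * Uniform boundedness over the reals *)

Section RestrictScalars.
Variables (R : realType) (V : normedModType R[i]).

(** Restricting the scalars to R gives a real-valued norm, so that the
    Banach-Steinhaus theorem for real normed spaces applies. *)
Definition real_module : Type := V.
HB.instance Definition _ := GRing.Zmodule.copy real_module V.

Definition real_scale (r : R) (v : real_module) : real_module :=
  ((r%:C)%C : R[i]) *: (v : V).

Fact real_scaleA (a b : R) v : real_scale a (real_scale b v) = real_scale (a * b) v.
Proof. by rewrite /real_scale scalerA rmorphM. Qed.
Fact real_scale1 : left_id 1 real_scale.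
Proof. by move=> v; rewrite /real_scale rmorph1 scale1r. Qed.
Fact real_scaleDr : right_distributive real_scale +%R.
Proof. by move=> a u v; rewrite /real_scale scalerDr. Qed.
Fact real_scaleDl v : {morph real_scale^~ v : a b / a + b}.
Proof. by move=> a b; rewrite /real_scale rmorphD scalerDl. Qed.

HB.instance Definition _ := GRing.Zmodule_isLmodule.Build R real_module
  real_scaleA real_scale1 real_scaleDr real_scaleDl.

Definition real_norm (v : V) : R := complex.Re `|v|.

Lemma real_normE (v : V) : `|v| = (real_norm v)%:C%C.
Proof.
have := normr_ge0 v; rewrite lecE /= => /andP[/eqP im _].
by rewrite [LHS]complexE im mulr0 addr0.
Qed.

Fact real_normD (u v : real_module) :
  real_norm (u + v) <= real_norm u + real_norm v.
Proof. by have := ler_normD (u : V) (v : V); rewrite !real_normE -rmorphD lecR. Qed.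
Fact real_normZ (r : R) (v : real_module) :
  real_norm (r *: v) = `|r| * real_norm v.
Proof.
have := normrZ (r%:C)%C (v : V); rewrite !real_normE normC_normc normc_real.
by rewrite -rmorphM => /complexI.
Qed.
Fact real_norm0 (v : real_module) : real_norm v = 0 -> v = 0.
Proof. by move=> v0; apply: (@normr0_eq0 _ V); rewrite real_normE v0. Qed.

HB.instance Definition _ := Lmodule_isNormed.Build R real_module
  real_normD real_normZ real_norm0.

Lemma real_module_complete : complete_space V -> complete_space real_module.
Proof.
move=> cV F PF cF.
have : cvg (F : set_system V).
  apply: cV; apply/cauchy_ballP => -[e ei]; rewrite ltcE /= => /andP[/eqP -> e0].
  have [[A B] /= FAB AB] := (cauchy_ballP F).2 cF e e0.
  exists (A, B) => // -[u v] uv; have := AB (u, v) uv.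
  by rewrite -!ball_normE /= real_normE ltcR.
move=> /cvg_ex[l Fl]; apply/cvg_ex; exists l.
apply/(@fcvgrPdist_lt R real_module) => e e0.
have /(@fcvgrPdist_lt _ V) := Fl; move=> /(_ (e%:C)%C); rewrite ltcR => /(_ e0).
by apply: filterS => v; rewrite real_normE ltcR.
Qed.

End RestrictScalars.

Section UniformBoundedness.
Variables (R : realType) (V : normedModType R[i]).

Lemma Re_linear_comb (r : R) (x y : R[i]) :
  complex.Re ((r%:C)%C * x + y) = r * complex.Re x + complex.Re y.
Proof. by case: x => a b; case: y => c d; rewrite /= mul0r subr0. Qed.

Lemma Im_linear_comb (r : R) (x y : R[i]) :
  complex.Im ((r%:C)%C * x + y) = r * complex.Im x + complex.Im y.
Proof. by case: x => a b; case: y => c d; rewrite /= mul0r addr0. Qed.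

(** Banach-Steinhaus for the real and imaginary parts of the functionals. *)
Lemma uniform_boundedness (I : Type) (lam : I -> V -> R[i]) :
  complete_space V ->
  (forall i c u v, lam i (c *: u + v) = c * lam i u + lam i v) ->
  (forall i, exists c : R, forall v, normc (lam i v) <= c * real_norm v) ->
  (forall v, exists c : R, forall i, normc (lam i v) <= c) ->
  exists A : R, forall i v, normc (lam i v) <= A * real_norm v.
Proof.
move=> cV lin bnd ptw.
pose W : completeNormedModType R := HB.pack (real_module V)
  (Uniform_isComplete.Build (real_module V) (real_module_complete cV)).
pose F := [set g : W -> R^o | exists i,
  g = (fun v => complex.Re (lam i v)) \/ g = (fun v => complex.Im (lam i v))].
have Flin g : F g -> bounded_fun_norm g /\ linear g.
  have bounded (p : R[i] -> R) i : (forall x, `|p x| <= normc x) ->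
      bounded_fun_norm ((fun v => p (lam i v)) : W -> R^o).
    move=> pn r; have [c cP] := bnd i.
    exists (`|c| * r) => v vr; apply: le_trans (pn _) _.
    apply: le_trans (cP v) _; apply: le_trans (_ : `|c| * real_norm v <= _).
      by rewrite ler_wpM2r ?ler_norm//; exact: (normr_ge0 (v : W)).
    by rewrite ler_wpM2l.
  move=> [i [->|->]]; split.
  - by apply: bounded; exact: Re_le_normc.
  - by move=> r u v; rewrite [lam i _]lin Re_linear_comb.
  - by apply: bounded; exact: Im_le_normc.
  - by move=> r u v; rewrite [lam i _]lin Im_linear_comb.
have Fptw : @sequences.pointwise_bounded R W R^o F.
  move=> v; have [c cP] := ptw v; exists c => g [i [->|->]].
    exact: le_trans (Re_le_normc _) (cP i).
  exact: le_trans (Im_le_normc _) (cP i).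
have [A AP] := @Banach_Steinhauss R W R^o F Flin Fptw 1.
exists (A + A) => i v.
have n0 : 0 <= real_norm v := normr_ge0 (v : W).
have unit (w : V) : real_norm w <= 1 -> normc (lam i w) <= A + A.
  move=> w1; apply: le_trans (normc_le_ReIm _) _; apply: lerD.
    by apply: (AP (fun v => complex.Re (lam i v))) => //; exists i; left.
  by apply: (AP (fun v => complex.Im (lam i v))) => //; exists i; right.
have lin0 w c : lam i (c *: w) = c * lam i w.
  have z0 : lam i 0 = 0.
    by have := lin i 1 0 0; rewrite scaler0 addr0 mul1r -{1}[lam i 0]addr0 => /addrI.
  by have := lin i c w 0; rewrite !addr0 z0 addr0.
have [v0|vn0] := eqVneq (real_norm v) 0.
  have [c cP] := bnd i; have := cP v; rewrite v0 !mulr0; exact.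
have vp : 0 < real_norm v by rewrite lt_neqAle eq_sym vn0.
have := unit (((real_norm v)^-1%:C)%C *: v).
rewrite lin0 normcM normc_real.
have -> : real_norm (((real_norm v)^-1)%:C%C *: v) = 1.
  have := real_normZ (real_norm v)^-1 v; rewrite ger0_norm ?invr_ge0// mulVf//.
rewrite ger0_norm ?invr_ge0// => /(_ (lexx 1)).
by rewrite mulrC ler_pdivrMr.
Qed.

End UniformBoundedness.

(** * Colourings of bounded sets *)

(** The sets whose complement in K has property Q form a filter, which is proper if
    K does not have the property; a cluster point in K then contradicts the local
    hypothesis. *)
Lemma compact_ind (T : topologicalType) (K : set T) (Q : set (set T)) :
  compact K -> Q set0 -> (forall A B, Q A -> Q B -> Q (A `|` B)) ->
  (forall A B, A `<=` B -> Q B -> Q A) ->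
  (forall x, K x -> exists2 U, nbhs x U & Q U) -> Q K.
Proof.
move=> cK Q0 QU Qsub locQ; apply: contrapT => nQK.
pose F := [set S | Q (K `\` S)].
have FF : ProperFilter F.
  apply: Build_ProperFilter.
    by rewrite /F /= setD0.
  split=> [|A B|A B AB]; first by rewrite /F /= setDT.
    by rewrite /F /= setDIr; exact: QU.
  by apply: Qsub; exact: setDS.
have FK : F K by rewrite /F /= setDv.
have [x [Kx clx]] := cK F FF FK; have [U nU QU'] := locQ x Kx.
have FU : F (~` U) by apply: Qsub QU'; rewrite setDE setCK; exact: subIsetr.
by have [y [yU]] := clx _ _ FU nU.
Qed.

Section Colorings.
Variable R : realType.

(** A colouring by a finite type encodes a finite partition; it is handier than a
    cover, since product colourings refine two partitions at once. *)
Lemma interval_coloring (B e : R) : 0 < e ->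
  exists (m : nat) (c : R -> 'I_m.+1), forall x y,
    `|x| <= B -> `|y| <= B -> c x = c y -> `|x - y| < e.
Proof.
move=> e0; pose s x := (x + B) / e.
exists (Num.truncn (2 * B / e)), (fun x => inord (Num.truncn (s x))) => x y xB yB cxy.
have s0 z : `|z| <= B -> 0 <= s z.
  by rewrite ler_norml => /andP[zB _]; apply: divr_ge0; [lra|exact: ltW].
have sm z : `|z| <= B -> (Num.truncn (s z) < (Num.truncn (2 * B / e)).+1)%N.
  move=> zB; rewrite ltnS le_truncn// ler_pM2r ?invr_gt0//.
  by move: zB; rewrite ler_norml => /andP[_]; lra.
have := congr1 (@nat_of_ord _) cxy; rewrite !inordK ?sm// => txy.
have /andP[x1 x2] := truncn_itv (s0 x xB).
have /andP[y1 y2] := truncn_itv (s0 y yB).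
rewrite txy -natr1 in x1 x2; rewrite -natr1 in y2.
have -> : x - y = (s x - s y) * e by rewrite /s; field; rewrite gt_eqF.
rewrite normrM (gtr0_norm e0) gtr_pMl//.
by rewrite ltr_norml; apply/andP; split; move: x1 x2 y1 y2; lra.
Qed.

Lemma disc_coloring (B e : R) : 0 < e ->
  exists (I : finType) (c : R[i] -> I), forall x y,
    normc x <= B -> normc y <= B -> c x = c y -> normc (x - y) < e.
Proof.
move=> e0; have [|m [c cP]] := @interval_coloring B (e / 2); first by rewrite divr_gt0.
exists ('I_m.+1 * 'I_m.+1)%type, (fun x => (c (complex.Re x), c (complex.Im x))).
move=> x y xB yB [cR cI]; apply: le_lt_trans (normc_le_ReIm _) _.
have := cP _ _ (le_trans (Re_le_normc x) xB) (le_trans (Re_le_normc y) yB) cR.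
have := cP _ _ (le_trans (Im_le_normc x) xB) (le_trans (Im_le_normc y) yB) cI.
have -> : complex.Re (x - y) = complex.Re x - complex.Re y by case: x {xB cR cI}; case: y {yB}.
have -> : complex.Im (x - y) = complex.Im x - complex.Im y by case: x {xB cR cI}; case: y {yB}.
by lra.
Qed.

End Colorings.

Section UnitBall.
Variables (R : realType) (Y : perfect_compact R) (M : weight_sequence R).
Implicit Types (f g : dales_davie Y M) (w z : Y).

Lemma dd_smooth f : csmooth f.
Proof. by have /dd_predP[] := dd_funP f. Qed.

Lemma series_dd_term_le f N : \sum_(n < N) dd_term M f n <= dd_norm M f.
Proof.
have /dd_predP[_ cf] := dd_funP f.
have := nondecreasing_cvgn_le (_ : nondecreasing_seq (series (dd_term M f))) cf N.
rewrite /series /= big_mkord; apply.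
by apply: nondecreasing_series => n _ _; exact: dd_term_ge0.
Qed.

Lemma sup_norm_le_dd_norm f k : sup_norm (cderivn k f) <= M k * dd_norm M f.
Proof.
rewrite mulrC -ler_pdivrMr ?weight_gt0//; apply: le_trans (series_dd_term_le f k.+1).
by rewrite big_ord_recr /= lerDr sumr_ge0// => i _; exact: dd_term_ge0.
Qed.

Lemma cderivn_lin k (c : R[i]) f g z :
  cderivn k (c *: f + g : dales_davie Y M) z = c * cderivn k f z + cderivn k g z.
Proof.
have [sZ Z] := csmoothZ c (@dd_smooth f).
by have [_ ->] := csmoothD sZ (@dd_smooth g); rewrite Z.
Qed.

(** The uniform boundedness principle for the difference quotients of [f^(k)] at z,
    indexed by the second point w.  The constant depends on z. *)
Lemma equilipschitz_at k z : complete_space (dales_davie Y M) ->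
  exists2 A : R, 0 <= A & forall f w,
    normc (cderivn k f w - cderivn k f z) <=
      A * dd_norm M f * normc (set_val w - set_val z).
Proof.
move=> cY.
pose lam w f := cquot (cderivn k f) z w.
have bnd f w : normc (cderivn k f w - cderivn k f z) <= 2 * M k * dd_norm M f.
  apply: le_trans (normc_triangle _ _) _; rewrite normcN -mulrA mulr_natl mulr2n.
  apply: lerD; apply: le_trans (sup_norm_le_dd_norm f k);
    exact: (le_sup_norm _ _ (@dd_smooth f)).
have [|w|f|A AP] := @uniform_boundedness R (dales_davie Y M) Y lam cY.
- move=> w c f g; rewrite /lam /cquot !cderivn_lin; ring.
- exists (2 * M k / normc (set_val w - set_val z)) => f.
  by rewrite /lam /cquot normcM normcV mulrAC ler_wpM2r ?invr_ge0 ?normc_ge0.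
- have /is_cderivE/(_ 1 ltr01)[d d0 dP] := @csmoothP _ _ f k z (@dd_smooth f).
  set l := cderivn k.+1 f z in dP.
  (* Close to z the quotients are within 1 of l; elsewhere the increment is at
     least d. *)
  exists (1 + normc l + 2 * M k * dd_norm M f / d) => w.
  have B0 : 0 <= 2 * M k * dd_norm M f.
    by rewrite !mulr_ge0 ?dd_norm_ge0 ?dd_funP// ltW// weight_gt0.
  have B0d : 0 <= 2 * M k * dd_norm M f / d by rewrite divr_ge0// ltW.
  have l0 := normc_ge0 l.
  rewrite /lam /cquot; set t := set_val w - set_val z.
  have [t0|tn0] := eqVneq t 0.
    by rewrite t0 invr0 mulr0 normc0 !addr_ge0.
  have nt0 : 0 < normc t by rewrite normc_gt0.
  rewrite normcM normcV ler_pdivrMr//.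
  have [td|dt] := ltP (normc t) d.
    have := dP w td; rewrite -/t mul1r => h.
    rewrite -[_ - _](subrK (l * t)); apply: le_trans (normc_triangle _ _) _.
    rewrite normcM !mulrDl mul1r.
    have h2 : 0 <= 2 * M k * dd_norm M f / d * normc t by rewrite mulr_ge0// ltW.
    by move: h h2; lra.
  apply: le_trans (bnd f w) _.
  rewrite [leRHS]mulrDl; apply: (@le_trans _ _ (2 * M k * dd_norm M f / d * normc t)).
    rewrite [leRHS]mulrAC -[leRHS]mulrA; apply: ler_peMr => //.
    by rewrite ler_pdivlMr// mul1r.
  by rewrite lerDr mulr_ge0// ?addr_ge0// ltW.
exists `|A| => // f w; set t := set_val w - set_val z.
have [t0|tn0] := eqVneq t 0.
  have -> : w = z by apply: val_inj; apply/eqP; rewrite -subr_eq0; apply/eqP.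
  by rewrite subrr normc0 mulr_ge0 ?normc_ge0// mulr_ge0// dd_norm_ge0// dd_funP.
have nt0 : 0 < normc t by rewrite normc_gt0.
have := AP w f; rewrite /lam /cquot normcM normcV ler_pdivrMr// -/t => /le_trans; apply.
rewrite ler_wpM2r ?normc_ge0// ler_wpM2r ?ler_norm//.
by rewrite dd_norm_ge0// dd_funP.
Qed.

(** The Arzela-Ascoli argument: near z the values of [f^(k)] are controlled by the
    value at z, which varies in a disc, and [compact_ind] glues the colourings. *)
Lemma derivative_coloring (A : set (dales_davie Y M)) (B e : R) k :
  complete_space (dales_davie Y M) -> (forall f, A f -> dd_norm M f <= B) ->
  0 < e -> exists (I : finType) (c : dales_davie Y M -> I), forall f g,
    A f -> A g -> c f = c g -> forall z, normc (cderivn k f z - cderivn k g z) <= e.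
Proof.
move=> cY AB e0.
pose Q := [set U : set Y | exists (I : finType) (c : dales_davie Y M -> I), forall f g,
    A f -> A g -> c f = c g -> forall z, U z -> normc (cderivn k f z - cderivn k g z) <= e].
suff : Q [set: Y].
  by move=> [I [c cP]]; exists I, c => f g Af Ag cfg z; exact: (cP f g).
apply: compact_ind.
- exact: set_val_compact.
- by exists unit, (fun=> tt).
- move=> U1 U2 [I1 [c1 c1P]] [I2 [c2 c2P]].
  exists (I1 * I2)%type, (fun f => (c1 f, c2 f)) => f g Af Ag [e1 e2] z [Uz|Uz].
    exact: (c1P f g).
  exact: (c2P f g).
- by move=> U1 U2 U12 [I [c cP]]; exists I, c => f g Af Ag cfg z /U12; exact: (cP f g).
move=> z _; have [L L0 LP] := equilipschitz_at k z cY.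
have e30 : 0 < e / 3 by rewrite divr_gt0.
have [I [c cP]] := @disc_coloring R (M k * B) _ e30.
pose D := L * `|B| + 1.
have D0 : 0 < D by rewrite ltr_wpDl// mulr_ge0.
exists [set w : Y | normc (set_val w - set_val z) < e / 3 / D].
  by apply/nbhs_set_valP; exists (e / 3 / D) => //; rewrite divr_gt0.
exists I, (fun f => c (cderivn k f z)) => f g Af Ag cfg w wz.
have near h : A h -> normc (cderivn k h w - cderivn k h z) <= e / 3.
  move=> Ah; apply: le_trans (LP h w) _.
  apply: (@le_trans _ _ (D * normc (set_val w - set_val z))).
    rewrite ler_wpM2r ?normc_ge0//; apply: (@le_trans _ _ (L * `|B|)).
      by rewrite ler_wpM2l// (le_trans (AB _ Ah))// ler_norm.
    by rewrite /D lerDl.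
  by rewrite mulrC -ler_pdivlMr// ltW.
have bd h : A h -> normc (cderivn k h z) <= M k * B.
  move=> Ah; apply: le_trans (le_sup_norm _ _ (@dd_smooth h)) _.
  apply: le_trans (sup_norm_le_dd_norm h k) _.
  by rewrite ler_wpM2l ?AB// ltW// weight_gt0.
have fg := cP _ _ (bd f Af) (bd g Ag) cfg.
have -> : cderivn k f w - cderivn k g w = (cderivn k f w - cderivn k f z) +
  ((cderivn k f z - cderivn k g z) - (cderivn k g w - cderivn k g z)) by ring.
apply: le_trans (normc_triangle _ _) _.
have := normc_triangle (cderivn k f z - cderivn k g z) (- (cderivn k g w - cderivn k g z)).
rewrite normcN; move: (near f Af) (near g Ag) fg; lra.
Qed.

Lemma derivatives_coloring (A : set (dales_davie Y M)) (B e : R) K :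
  complete_space (dales_davie Y M) -> (forall f, A f -> dd_norm M f <= B) ->
  0 < e -> exists (I : finType) (c : dales_davie Y M -> I), forall f g,
    A f -> A g -> c f = c g -> forall k, (k < K)%N ->
    forall z, normc (cderivn k f z - cderivn k g z) <= e.
Proof.
move=> cY AB e0; elim: K => [|K [I [c cP]]]; first by exists unit, (fun=> tt).
have [J [d dP]] := derivative_coloring K cY AB e0.
exists (I * J)%type, (fun f => (c f, d f)) => f g Af Ag [cfg dfg] k.
rewrite ltnS leq_eqVlt => /orP[/eqP ->|kK z]; first exact: dP.
exact: (cP f g).
Qed.

End UnitBall.

(** * Compactness *)

Lemma ultra_finite_cover (T : Type) (F : set_system T) (I : finType) (S : I -> set T) :
  UltraFilter F -> F [set x | exists i, S i x] -> exists i, F (S i).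
Proof.
move=> UF FS; apply: contrapT => nS.
have FC : F [set x | forall i, (~` S i) x].
  apply: filter_forall => i.
  by have [Fi|//] := in_ultra_setVsetC (S i) UF; case: nS; exists i.
have [x [[i Six]]] := filter_ex (filterI FS FC).
by move=> /(_ i).
Qed.

(** For each e the closure of the image is covered by finitely many sets of diameter
    less than e, and an ultrafilter on it contains one of them; so it is Cauchy. *)
Lemma precompact_of_coloring (R : realType) (W : normedModType R[i]) (T : Type)
    (h : T -> W) (A : set T) :
  complete_space W ->
  (forall e : R, 0 < e -> exists (I : finType) (c : T -> I), forall s t,
    A s -> A t -> c s = c t -> real_norm (h s - h t) <= e) ->
  precompact (h @` A).
Proof.
move=> cW col; rewrite precompactE compact_ultra => F UF FA.
have PF : ProperFilter F by exact: ultra_proper.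
have : cvg F.
  apply: cW; apply/cauchy_ballP => -[e ei]; rewrite ltcE /= => /andP[/eqP -> e0].
  have e30 : 0 < e / 3 by rewrite divr_gt0.
  have [I [c cP]] := col _ e30.
  pose S i := [set w : W | exists t, [/\ A t, c t = i & real_norm (w - h t) < e / 3]].
  have [|i Fi] := @ultra_finite_cover _ F I S UF.
    apply: filterS FA => w /(_ (ball w ((e / 3)%:C)%C)).
    have nb : nbhs w (ball w ((e / 3)%:C)%C) by apply: nbhsx_ballx; rewrite ltcR.
    move=> /(_ nb)[_ [[t At <-]]]; rewrite -ball_normE /= real_normE ltcR => wt.
    by exists (c t), t.
  exists (S i, S i) => // -[u v] /= [[s [As cs us]] [t [At ct vt]]].
  rewrite -ball_normE /= real_normE ltcR.
  have -> : u - v = (u - h s) + ((h s - h t) - (v - h t)).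
    by rewrite opprB !subrKA.
  have st := cP s t As At (etrans cs (esym ct)).
  have nN (x : W) : real_norm (- x) = real_norm x by rewrite /real_norm normrN.
  apply: le_lt_trans (real_normD _ _) _.
  by have := real_normD (h s - h t) (- (v - h t)); rewrite nN; move: us vt st; lra.
move=> /cvg_ex[p Fp]; exists p; split; last exact: Fp.
move=> U Up.
have [w [clw Uw]] := filter_ex (filterI FA (Fp _ (nbhs_interior Up))).
exact: (clw U Uw).
Qed.

Theorem theorem6 (R : realType) (X Y : perfect_compact R)
    (M : weight_sequence R) (phi : X -> Y)
    (X_locally_good : locally_good X M)
    (Y_good : good_algebra Y M)
    (phi_analytic : analytic_map (set_val \o phi))
    (X_cover : [set: X] =
       [set z : X | `|cderiv (set_val \o phi) z| < 1] `|`
       phi @^-1` (set_val @^-1` (Y : set R[i])°)) :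
  exists T : {linear dales_davie Y M -> dales_davie X M},
    [/\ forall f : dales_davie Y M, (T f : X -> R[i]) = f \o phi,
        monoid_morphism T &
        compact_operator T].
Proof.
have [[gX _ _] _] := X_locally_good; have [gY naM _] := Y_good.
have [q [K [K' [/andP[q0 q1] K0 K'0 est]]]] :=
  composition_estimate naM phi_analytic X_cover.
have weighted (g : dales_davie Y M) N :
    \sum_(k < N) K * q ^+ k * dd_term M g k <= K * dd_norm M g.
  apply: le_trans (_ : \sum_(k < N) K * dd_term M g k <= _).
    apply: ler_sum => k _; rewrite ler_wpM2r ?dd_term_ge0// ler_piMr//.
    by rewrite exprn_ile1// ltW.
  by rewrite -mulr_sumr ler_wpM2l// series_dd_term_le.
have Tin (f : dales_davie Y M) : (f \o phi : X -> R[i]) \in @dd_pred R X M.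
  apply/dd_predP; split.
    by apply: csmooth_comp; [exact: phi_analytic.1|exact: dd_smooth].
  apply: nondecreasing_is_cvgn.
    by apply: nondecreasing_series => n _ _; exact: dd_term_ge0.
  exists (K * dd_norm M f + K' * sup_norm f) => _ [N _ <-].
  rewrite /series /= big_mkord; apply: le_trans (est f (@dd_smooth _ _ _ f) N) _.
  by rewrite lerD2r; exact: weighted.
pose T0 f : dales_davie X M := DalesDavie (Tin f).
have T0lin : linear T0 by move=> c f g; apply: val_inj.
pose T : {linear dales_davie Y M -> dales_davie X M} :=
  HB.pack T0 (GRing.isLinear.Build _ _ _ _ T0 T0lin).
exists T; split => //.
  by split=> [|f g]; exact: val_inj.
move=> A [[B0 Bi] [+ AB]]; rewrite complex_real /= => /eqP Bi0.
have {}AB f : A f -> dd_norm M f <= `|B0| + 1.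
  move=> Af; have := AB ((`|B0| + 1)%:C)%C.
  rewrite ltcE /= Bi0 eqxx /= ltr_pwDr ?ler_norm// => /(_ isT f Af).
  by rewrite dales_davie_normE lecR.
move: (`|B0| + 1) AB => B AB.
apply: precompact_of_coloring; first exact: gX.
move=> e e0.
pose B' := 2 * `|B| + 1.
have B'0 : 0 < B' by rewrite ltr_wpDl// mulr_ge0.
(* From order n on, the factor q^n alone makes the terms small. *)
have [n nP] : exists n, K * q ^+ n * B' <= e / 2.
  have : K * q ^+ n * B' @[n --> \oo] --> K * 0 * B'.
    apply: cvgM; last exact: cvg_cst.
    by apply: cvgM; [exact: cvg_cst|apply: cvg_expr; rewrite ger0_norm].
  rewrite mulr0 mul0r => /cvgrPdist_le/(_ (e / 2)).
  move=> /(_ ltac:(by rewrite divr_gt0)) [n _ nP]; exists n.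
  apply: le_trans (ler_norm _) _.
  by have := nP n (leqnn n); rewrite /= sub0r normrN.
(* D is the total weight of the derivatives of order at most n, including the
   term K' |h|_oo of the estimate, increased by 1 to be positive. *)
pose D := \sum_(k < n.+1) K / M k + K' + 1.
have S0 : 0 <= \sum_(k < n.+1) K / M k.
  by apply: sumr_ge0 => k _; rewrite divr_ge0// ltW// weight_gt0.
have D0 : 0 < D by rewrite ltr_wpDl// addr_ge0.
have e20 : 0 < e / 2 / D by rewrite !divr_gt0.
have [I [c cP]] := derivatives_coloring n.+1 (@gY M) AB e20.
exists I, c => f g Af Ag cfg.
pose h := f - g.
have -> : T0 f - T0 g = T0 h by apply: val_inj.
have hE k z : cderivn k h z = cderivn k f z - cderivn k g z.
  have -> : h = -1 *: g + f by rewrite /h scaleN1r addrC.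
  by rewrite cderivn_lin mulN1r addrC.
have hk k : (k < n.+1)%N -> sup_norm (cderivn k h) <= e / 2 / D.
  by move=> kn; apply: sup_norm_le => [|z]; [exact: ltW|rewrite hE; exact: (cP f g)].
have hB : dd_norm M h <= B'.
  have := ler_normB f g; rewrite !dales_davie_normE -rmorphD lecR => /le_trans; apply.
  by rewrite /B'; have := ler_norm B; have := AB f Af; have := AB g Ag; lra.
have hterm k : 0 <= dd_term M h k by exact: dd_term_ge0.
rewrite [X in X <= _](_ : _ = dd_norm M (h \o phi))//.
apply: limr_le; first by have /dd_predP[] := Tin h.
apply: nearW => N; rewrite /series /= big_mkord.
apply: le_trans (est h (@dd_smooth _ _ _ h) N) _.
have split_sum : \sum_(k < N) K * q ^+ k * dd_term M h k <=
    \sum_(k < n.+1) K / M k * (e / 2 / D) + K * q ^+ n * dd_norm M h.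
  pose head k := if (k < n.+1)%N then K / M k * (e / 2 / D) else 0.
  have head0 k : 0 <= head k.
    rewrite /head; case: ifP => // _; apply: mulr_ge0; last exact: ltW.
    by rewrite divr_ge0// ltW// weight_gt0.
  have tail : \sum_(k < N) K * q ^+ n * dd_term M h k <= K * q ^+ n * dd_norm M h.
    by rewrite -mulr_sumr ler_wpM2l ?series_dd_term_le// mulr_ge0// exprn_ge0.
  apply: le_trans (lerD _ tail); last first.
    pose m := maxn N n.+1.
    have Em : \sum_(k < n.+1) K / M k * (e / 2 / D) = \sum_(k < m) head k.
      rewrite (big_ord_widen m (fun k => K / M k * (e / 2 / D))) ?leq_maxr//.
      by rewrite big_mkcond.
    rewrite Em; apply: le_trans (_ : \sum_(k < m | (k < N)%N) head k <= _).
      by rewrite -(big_ord_widen m head) ?leq_maxl.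
    by rewrite big_mkcond; apply: ler_sum => k _; case: ifP.
  rewrite -big_split /=; apply: ler_sum => k _; rewrite /head.
  case: ltnP => kn; last first.
    rewrite add0r ler_wpM2r// ler_wpM2l// ler_wiXn2l// ?ltW//.
    exact: ltnW.
  apply: ler_wpDr; first by apply: mulr_ge0 => //; rewrite mulr_ge0// exprn_ge0.
  rewrite -[leLHS]mulrA -[leRHS]mulrA ler_wpM2l//.
  apply: (@le_trans _ _ (dd_term M h k)).
    by rewrite ler_piMl// exprn_ile1// ltW.
  rewrite /dd_term mulrC; apply: ler_wpM2l; last exact: hk.
  by rewrite invr_ge0 ltW// weight_gt0.
have hK' : K' * sup_norm h <= K' * (e / 2 / D).
  by rewrite ler_wpM2l//; exact: (hk 0%N).
apply: le_trans (lerD split_sum hK') _.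
rewrite -mulr_suml addrAC -mulrDl.
apply: (@le_trans _ _ (D * (e / 2 / D) + e / 2)).
  apply: lerD.
    by rewrite ler_pM2r// /D lerDl.
  by apply: le_trans nP; rewrite ler_wpM2l// mulr_ge0// exprn_ge0.
by rewrite mulrC divfK ?gt_eqF//; lra.
Qed.
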